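(* Let $X$ be an infinite-dimensional complex Banach space and let $T\in\mathcal{B}(X)$. If $T$ or its dual $T^*$ has the single-valued extension property on $\mathbb{C}\setminus\sigma_W(T)$, then $T$ satisfies property $(Z_{E_a})$ if and only if $E_a(T)=\Pi^0(T)$.
   Context: $\mathcal{B}(X)$ is the algebra of bounded linear operators on $X$ and $I$ is the identity; $T^*\in\mathcal{B}(X^* )$ is the dual operator. For $S\in\mathcal{B}(X)$, $\mathcal{N}(S)$ and $\mathcal{R}(S)$ are its null space and range, $\sigma(S)$ its spectrum, and $\sigma_a(S)$ its approximate point spectrum ($\lambda\in\sigma_a(S)$ iff $S-\lambda I$ is not bounded below). $S\in\mathcal{B}(X)$ is Fredholm if $\dim\mathcal{N}(S)<\infty$ and $\operatorname{codim}\mathcal{R}(S)<\infty$, with index $\dim\mathcal{N}(S)-\operatorname{codim}\mathcal{R}(S)$; it is Weyl if it is Fredholm of index $0$. The Weyl spectrum is $\sigma_W(T)=\{\lambda\in\mathbb{C}: T-\lambda I \text{ is not Weyl}\}$. A bounded operator $S$ on a complex Banach space $Y$ has the single-valued extension property (SVEP) at $\lambda\in\mathbb{C}$ if for every open neighborhood $U_\lambda$ of $\lambda$, the function $f\equiv 0$ is the only analytic function $f:U_\lambda\to Y$ satisfying $(S-\mu I)f(\mu)=0$ for all $\mu\in U_\lambda$. $S$ has SVEP on $A\subset\mathbb{C}$ if it has SVEP at every $\lambda\in A$. The ascent and descent of $S$ are $a(S)=\inf\{n\in\mathbb{N}:\mathcal{N}(S^n)=\mathcal{N}(S^{n+1})\}$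 and $\delta(S)=\inf\{n\in\mathbb{N}:\mathcal{R}(S^n)=\mathcal{R}(S^{n+1})\}$, with $\mathbb{N}=\{0,1,2,\dots\}$ and $\inf\emptyset=\infty$. $\lambda\in\sigma(T)$ is a pole of $T$ if $T-\lambda I$ has finite ascent and finite descent; it is of finite rank if $\dim\mathcal{N}(T-\lambda I)<\infty$. $\Pi^0(T)$ is the set of poles of $T$ of finite rank. $\mathrm{iso}\,A$ denotes the set of isolated points of $A\subset\mathbb{C}$, $\sigma_p(T)$ the set of eigenvalues of $T$, and $E_a(T)=\mathrm{iso}\,\sigma_a(T)\cap\sigma_p(T)$. $T$ satisfies property $(Z_{E_a})$ if $\sigma(T)\setminus\sigma_W(T)=E_a(T)$. *)

(* Defs.v *)
From HB Require Import structures.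
From mathcomp Require Import all_boot all_order all_algebra.
From mathcomp Require Import complex.
From mathcomp Require Import all_classical all_reals all_analysis.

Set Implicit Arguments.
Unset Strict Implicit.
Unset Printing Implicit Defensive.

Import Order.TTheory GRing.Theory Num.Theory.
Import numFieldNormedType.Exports.

Local Open Scope classical_set_scope.
Local Open Scope ring_scope.

Section BoundedMap.
Variables (K : numFieldType) (V W : normedModType K).

Definition bounded_map (f : V -> W) : Prop :=
  exists M : K, forall x : V, `|f x| <= M * `|x|.

Lemma bounded_map_ge0 (f : V -> W) : bounded_map f ->
  exists2 M : K, 0 <= M & forall x : V, `|f x| <= M * `|x|.
Proof.
move=> [M fM]; have [x0|/existsNP[x /eqP x0]] := pselect (forall x : V, x = 0).
  exists `|f 0|; first exact: normr_ge0.
  by move=> x; rewrite (x0 x); have := fM 0; rewrite !normr0 !mulr0.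
exists M => //; have nx : 0 < `|x| by rewrite normr_gt0.
by rewrite -(pmulr_lge0 _ nx); exact: le_trans (fM x).
Qed.

End BoundedMap.

Record bounded_operator (K : numFieldType) (X : normedModType K) :=
  BoundedOperator {
    bop_fun :> {linear X -> X} ;
    bop_bounded : bounded_map bop_fun }.

Section Dimension.
Variables (K : fieldType) (V : lmodType K).

Definition has_dim (A : set V) (n : nat) : Prop :=
  exists b : 'I_n -> V,
    (forall c : 'I_n -> K, \sum_i c i *: b i = 0 -> forall i, c i = 0) /\
    A = [set v | exists c : 'I_n -> K, v = \sum_i c i *: b i].

(* The classes of [b] form a basis of the quotient V / A. *)
Definition has_codim (A : set V) (n : nat) : Prop :=
  exists b : 'I_n -> V,
    (forall c : 'I_n -> K, A (\sum_i c i *: b i) -> forall i, c i = 0) /\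
    (forall v, exists c : 'I_n -> K, A (v - \sum_i c i *: b i)).

Definition finite_dim (A : set V) : Prop := exists n, has_dim A n.

Definition finite_codim (A : set V) : Prop := exists n, has_codim A n.

(* Junk value 0 when the (co)dimension is infinite. *)
Definition dim (A : set V) : nat := xget 0%N [set n | has_dim A n].

Definition codim (A : set V) : nat := xget 0%N [set n | has_codim A n].

End Dimension.

Section Operators.
Variables (K : numFieldType) (X : normedModType K).
Implicit Types (S : X -> X) (T : bounded_operator X).

Definition null_space S : set X := [set x | S x = 0].

(* The operator T - l I. *)
Definition shift_op T (l : K) : X -> X := fun x => T x - l *: x.

Definition invertible_op S : Prop :=
  exists S' : bounded_operator X, cancel S S' /\ cancel S' S.

Definition bounded_below S : Prop :=
  exists2 c : K, 0 < c & forall x : X, c * `|x| <= `|S x|.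

Definition spectrum T : set K := [set l | ~ invertible_op (shift_op T l)].

Definition approx_point_spectrum T : set K :=
  [set l | ~ bounded_below (shift_op T l)].

Definition point_spectrum T : set K :=
  [set l | exists2 x : X, x != 0 & T x = l *: x].

Definition fredholm S : Prop :=
  finite_dim (null_space S) /\ finite_codim (range S).

Definition fredholm_index S : int :=
  (dim (null_space S))%:Z - (codim (range S))%:Z.

Definition weyl S : Prop := fredholm S /\ fredholm_index S = 0.

Definition weyl_spectrum T : set K := [set l | ~ weyl (shift_op T l)].

(* The ascent (resp. descent), an infimum of a set of naturals, is finite iff
   that set is nonempty. *)
Definition finite_ascent S : Prop :=
  exists n, null_space (iter n S) = null_space (iter n.+1 S).

Definition finite_descent S : Prop :=
  exists n, range (iter n S) = range (iter n.+1 S).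

Definition pole T (l : K) : Prop :=
  spectrum T l /\ finite_ascent (shift_op T l) /\ finite_descent (shift_op T l).

Definition finite_rank_poles T : set K :=
  [set l | pole T l /\ finite_dim (null_space (shift_op T l))].

Definition isolated_approx_eigenvalues T : set K :=
  isolated (approx_point_spectrum T) `&` point_spectrum T.

Definition property_Z_Ea T : Prop :=
  spectrum T `\` weyl_spectrum T = isolated_approx_eigenvalues T.

(* Analyticity on the open set [U] is complex differentiability at every point
   of [U]; the values of [f] outside [U] are irrelevant.  Neighborhoods are
   taken connected: on a disconnected [U] the condition would also constrain
   components not containing [l], and SVEP at one point would amount to SVEP at
   every point.  This is implied by the condition over all open [U]. *)
Definition svep_at T (l : K) : Prop :=
  forall U : set K, open U -> connected U -> U l ->
  forall f : K^o -> X,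
    (forall z, U z -> derivable f z 1) ->
    (forall z, U z -> shift_op T z (f z) = 0) ->
    forall z, U z -> f z = 0.

Definition svep_on T (A : set K) : Prop := forall l, A l -> svep_at T l.

End Operators.

Section Dual.
Variables (R : realType) (X : normedModType R[i]).
Local Notation C := (R[i]^o).

Definition bounded_functional : {pred (X -> C)} :=
  fun f => `[< linear f /\ bounded_map f >].

Lemma bounded_functionalP (f : X -> C) :
  reflect (linear f /\ bounded_map f) (f \in bounded_functional).
Proof. exact: asboolP. Qed.

Record dual := Dual {
  dual_fun :> X -> C ;
  dual_funP : dual_fun \in bounded_functional }.

HB.instance Definition _ := [isSub for dual_fun].
HB.instance Definition _ := [Choice of dual by <:].

Lemma bounded_functional_submod : submod_closed bounded_functional.
Proof.
split=> [|a f g /bounded_functionalP[lf bf] /bounded_functionalP[lg bg]];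
  apply/bounded_functionalP; split.
- by move=> a x y; rewrite /GRing.zero/= scaler0 addr0.
- by exists 0 => x; rewrite /GRing.zero/= normr0 mul0r.
- move=> b x y; have E z : (a *: f + g) z = a *: f z + g z by [].
  by rewrite !E lf lg !scalerDr !scalerA [a * b]mulrC addrACA.
- have [M M0 fM] := bounded_map_ge0 bf; have [N N0 gN] := bounded_map_ge0 bg.
  exists (`|a| * M + N) => x; have -> : (a *: f + g) x = a *: f x + g x by [].
  rewrite (le_trans (ler_normD _ _))// mulrDl lerD//.
  by rewrite normrZ -mulrA ler_wpM2l.
Qed.

HB.instance Definition _ :=
  GRing.isSubmodClosed.Build _ _ bounded_functional bounded_functional_submod.
HB.instance Definition _ := [SubChoice_isSubLmodule of dual by <:].

Lemma dual_linear (f : dual) : linear f.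
Proof. by have /bounded_functionalP[] := dual_funP f. Qed.

Lemma dual0 (f : dual) : f 0 = 0.
Proof.
have := dual_linear f 1 0 0; rewrite !scale1r addr0 -[LHS]addr0.
by move/addrI.
Qed.

Lemma dualZ (f : dual) a x : f (a *: x) = a * f x.
Proof. by have := dual_linear f a x 0; rewrite !addr0 dual0 addr0. Qed.

Lemma dual_bounded (f : dual) : bounded_map f.
Proof. by have /bounded_functionalP[] := dual_funP f. Qed.

Lemma dualP (f g : dual) : (forall x, f x = g x) -> f = g.
Proof. by move=> fg; apply: val_inj; apply/funext. Qed.

Lemma dualDE (f g : dual) x : (f + g) x = f x + g x. Proof. by []. Qed.

Lemma dualZE (a : R[i]) (f : dual) x : (a *: f) x = a * f x.
Proof. by []. Qed.

Definition dual_values (f : dual) : set R :=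
  [set Normc.normc (f x) | x in [set x : X | `|x| <= 1]].

(* The norm of an [R[i]]-normed module takes values in [R[i]]; the supremum is
   therefore taken in [R] and embedded. *)
Definition dual_norm (f : dual) : R[i] := (sup (dual_values f))%:C%C.

Lemma dual_values_has_sup (f : dual) : has_sup (dual_values f).
Proof.
split.
  by exists (Normc.normc (f 0)), 0 => //=; rewrite normr0.
have [M M0 fM] := bounded_map_ge0 (dual_bounded f).
exists (complex.Re M) => _ [x /= x1 <-].
rewrite -lecR RRe_real ?ger0_real//.
by rewrite (le_trans (fM x))// ler_piMr.
Qed.

Lemma dual_norm_ge0 (f : dual) : 0 <= dual_norm f.
Proof.
rewrite /dual_norm ler0c; apply: (@le_trans _ _ (Normc.normc (f 0))).
  by rewrite -ler0c; exact: (normr_ge0 (f 0)).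
apply: ub_le_sup; first exact: (dual_values_has_sup f).2.
by exists 0 => //=; rewrite normr0.
Qed.

Lemma dual_norm_le (f : dual) (x : X) : `|f x| <= dual_norm f * `|x|.
Proof.
have [->|x0] := eqVneq x 0.
  by rewrite dual0 !normr0 mulr0.
have nx : 0 < `|x| by rewrite normr_gt0.
rewrite -ler_pdivrMr//.
have -> : `|f x| / `|x| = `|f (`|x|^-1 *: x)|.
  by rewrite dualZ normrM normfV normr_id mulrC.
change (`|f (`|x|^-1 *: x)|) with
  ((Normc.normc (f (`|x|^-1 *: x)))%:C%C).
rewrite /dual_norm lecR; apply: ub_le_sup.
  exact: (dual_values_has_sup f).2.
exists (`|x|^-1 *: x) => //=.
by rewrite normrZ normfV normr_id mulVf// gt_eqF.
Qed.

Lemma dual_norm_ub (f : dual) (M : R[i]) : 0 <= M ->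
  (forall x, `|f x| <= M * `|x|) -> dual_norm f <= M.
Proof.
move=> M0 fM; rewrite -(RRe_real (ger0_real M0)) /dual_norm lecR.
apply: ge_sup; first exact: (dual_values_has_sup f).1.
move=> _ [x /= x1 <-]; rewrite -lecR RRe_real ?ger0_real//.
by rewrite (le_trans (fM x))// ler_piMr.
Qed.

Lemma dual_normD (f g : dual) : dual_norm (f + g) <= dual_norm f + dual_norm g.
Proof.
apply: dual_norm_ub => [|x]; first by rewrite addr_ge0 ?dual_norm_ge0.
by rewrite dualDE (le_trans (ler_normD _ _))// mulrDl lerD// dual_norm_le.
Qed.

Lemma dual_normZ (a : R[i]) (f : dual) :
  dual_norm (a *: f) = `|a| * dual_norm f.
Proof.
have le b h : dual_norm (b *: h) <= `|b| * dual_norm h.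
  apply: dual_norm_ub => [|x]; first by rewrite mulr_ge0 ?dual_norm_ge0.
  by rewrite dualZE normrM -mulrA ler_wpM2l// dual_norm_le.
apply/le_anti; rewrite le/=; have [->|a0] := eqVneq a 0.
  by rewrite normr0 mul0r dual_norm_ge0.
have na : 0 < `|a| by rewrite normr_gt0.
rewrite mulrC -ler_pdivlMr// mulrC -normfV.
by have := le a^-1 (a *: f); rewrite scalerA mulVf// scale1r.
Qed.

Lemma dual_norm0_eq0 (f : dual) : dual_norm f = 0 -> f = 0.
Proof.
move=> f0; apply: dualP => x; apply/eqP; rewrite -normr_le0.
by have := dual_norm_le f x; rewrite f0 mul0r.
Qed.

HB.instance Definition _ := Lmodule_isNormed.Build R[i] dual
  dual_normD dual_normZ dual_norm0_eq0.

End Dual.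

Section DualOperator.
Variables (R : realType) (X : normedModType R[i]) (T : bounded_operator X).

Lemma dual_op_subproof (f : dual X) :
  (fun x => f (T x)) \in @bounded_functional R X.
Proof.
apply/bounded_functionalP; split.
  by move=> a x y; rewrite linearP dual_linear.
have [M M0 TM] := bounded_map_ge0 (bop_bounded T).
exists (dual_norm f * M) => x; rewrite (le_trans (dual_norm_le _ _))// -mulrA.
by rewrite ler_wpM2l ?dual_norm_ge0.
Qed.

Definition dual_op_fun (f : dual X) : dual X := Dual (dual_op_subproof f).

Lemma dual_op_linear : linear dual_op_fun.
Proof. by move=> a f g; apply: dualP. Qed.

HB.instance Definition _ :=
  GRing.isLinear.Build _ _ _ _ dual_op_fun dual_op_linear.

Lemma dual_op_bounded : bounded_map dual_op_fun.
Proof.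
have [M M0 TM] := bounded_map_ge0 (bop_bounded T).
exists M => f; apply: dual_norm_ub => [|x]; first by rewrite mulr_ge0.
rewrite (le_trans (dual_norm_le f _))// [M * _]mulrC -mulrA.
by apply: ler_wpM2l => //; exact: dual_norm_ge0.
Qed.

Definition dual_op : bounded_operator (dual X) :=
  BoundedOperator dual_op_bounded.

End DualOperator.

(* Main.v *)
From HB Require Import structures.
Require Import Defs.
From mathcomp Require Import all_boot all_order all_algebra.
From mathcomp Require Import complex.
From mathcomp Require Import all_classical all_reals all_analysis.
From mathcomp Require Import ring lra.
Import numFieldNormedType.Exports.
Import Order.TTheory GRing.Theory Num.Theory.
Set Implicit Arguments.
Unset Strict Implicit.
Unset Printing Implicit Defensive.
Local Open Scope classical_set_scope.
Local Open Scope ring_scope.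

(** The theorem is Browder's theorem in disguise: under the SVEP hypothesis
    [spectrum T `\` weyl_spectrum T] is exactly [finite_rank_poles T], and then
    [property_Z_Ea T] and the equality
    [isolated_approx_eigenvalues T = finite_rank_poles T] assert the same
    thing.  Write [S] for [shift_op T l].

    That a pole of finite rank is a Weyl point is linear algebra.  If the
    kernels of the powers of [S] stabilize at [K], then [S] acts on the
    finite-dimensional space [K], so [dim (K / S K) = dim ker S], and
    [K] meets the range of [S] in [S K] ([stable_ker_mod_ran]).  Finite descent
    makes [K] and the range of [S] span the whole space, so that the codimension
    of the range is [dim ker S] as well ([codim_ran_of_stable]).

    Conversely, let [S] be Weyl.  By the same counting, finite ascent gives
    finite descent ([stable_ker_stable_ran]) and finite descent gives finite
    ascent ([ker_meet_stable_ran]); so one of the two chain conditions is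
    enough.

    SVEP of [T] at [l] gives finite ascent.  The decreasing sequence of the
    subspaces [ker S] intersected with the range of [S^n] stabilizes.  If it
    does not stabilize at zero, there is a nonzero [x 0] in [ker S] that lies in
    the range of every power; it can be lifted step by step to a sequence with
    [S (x n.+1) = x n] and [|x n|] growing at most geometrically, and
    [z |-> \sum_n (z - l)^n x n] is an analytic family of eigenvectors of [T]
    near [l] with the value [x 0] at [l], which SVEP forbids
    ([backward_orbit_svep], [svep_finite_ascent]).  The geometric bound comes
    from an open mapping theorem for operators with range of finite codimension
    ([bounded_decomposition]): every [v] is [A x + \sum_i c i b i] with [x] and
    [c] of size at most a constant times [|v|].

    SVEP of the dual operator gives finite descent of [S].  The dual of [S]
    satisfies the two hypotheses of [svep_finite_ascent]: its kernel is finite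
    dimensional because a functional vanishing on the range of [S] is determined
    by its values on a complement, and preimages under its powers can be chosen
    with a norm bound, again by [bounded_decomposition] ([dual_iter_lift]).  So
    the dual has finite ascent.  The coefficient maps [v |-> c i] are bounded
    functionals, and they separate points from the ranges of the powers of [S],
    so these ranges stabilize as soon as their annihilators do
    ([dual_stable_ker_stable_ran]).  *)

(** * Dimension of one subspace modulo another *)

Section RelativeDimension.
Variables (K : fieldType) (V : lmodType K).
Implicit Types (A B C : set V).

Definition subspace A : Prop :=
  A 0 /\ forall (a : K) x y, A x -> A y -> A (a *: x + y).

Lemma subspaceD A x y : subspace A -> A x -> A y -> A (x + y).
Proof. by move=> [_ lA] Ax Ay; rewrite -[x]scale1r; exact: lA. Qed.

Lemma subspaceZ A a x : subspace A -> A x -> A (a *: x).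
Proof. by move=> [A0 lA] Ax; rewrite -[_ *: _]addr0; exact: lA. Qed.

Lemma subspaceB A x y : subspace A -> A x -> A y -> A (x - y).
Proof.
by move=> sA Ax Ay; apply: subspaceD => //; rewrite -scaleN1r; exact: subspaceZ.
Qed.

Lemma subspace_sum A n (c : 'I_n -> K) (v : 'I_n -> V) :
  subspace A -> (forall i, A (v i)) -> A (\sum_i c i *: v i).
Proof.
move=> sA Av; elim/big_ind: _ => [|x y Ax Ay|i _]; first by case: sA.
  exact: subspaceD.
exact: subspaceZ.
Qed.

Lemma subspace_ge0 A : subspace A -> [set 0] `<=` A.
Proof. by move=> [A0 _] _ ->. Qed.

Lemma subspaceT : subspace [set: V]. Proof. by []. Qed.

Lemma subspace0 : subspace [set 0 : V].
Proof. by split=> // a x y /= -> ->; rewrite scaler0 addr0. Qed.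

Lemma subspaceI A B : subspace A -> subspace B -> subspace (A `&` B).
Proof.
move=> [A0 lA] [B0 lB]; split=> // a x y [Ax Bx] [Ay By].
by split; [exact: lA|exact: lB].
Qed.

Definition cons_family T n (x : T) (v : 'I_n -> T) (i : 'I_n.+1) : T :=
  oapp v x (unlift ord0 i).

Definition cat_family T n m (v : 'I_n -> T) (w : 'I_m -> T)
    (i : 'I_(n + m)) : T :=
  match fintype.split i with inl j => v j | inr j => w j end.

Lemma cat_familyl T n m (v : 'I_n -> T) (w : 'I_m -> T) i :
  cat_family v w (lshift m i) = v i.
Proof. by rewrite /cat_family (unsplitK (inl i)). Qed.

Lemma cat_familyr T n m (v : 'I_n -> T) (w : 'I_m -> T) i :
  cat_family v w (rshift n i) = w i.
Proof. by rewrite /cat_family (unsplitK (inr i)). Qed.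

Definition independent_mod B n (v : 'I_n -> V) : Prop :=
  forall c : 'I_n -> K, B (\sum_i c i *: v i) -> forall i, c i = 0.

Definition spanning_mod A B n (v : 'I_n -> V) : Prop :=
  forall x, A x -> exists c : 'I_n -> K, B (x - \sum_i c i *: v i).

(** The dimension of [A / (A `&` B)], for [B] possibly not contained in [A]: one
    notion then covers dimension ([B = 0]), codimension ([A] everything) and
    successive quotients, and [A / (A `&` B) = (A + B) / B] needs no proof. *)
Definition reldim A B n : Prop :=
  exists v : 'I_n -> V,
    [/\ forall i, A (v i), independent_mod B v & spanning_mod A B v].

Lemma reldim_has_dim A n : subspace A -> has_dim A n <-> reldim A [set 0] n.
Proof.
move=> sA; split.
  move=> [b [ib Ab]]; exists b; split=> //.
    move=> i; rewrite Ab /=; exists (fun j => (j == i)%:R).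
    rewrite (bigD1 i)//= eqxx scale1r big1 ?addr0// => j ji.
    by rewrite (negbTE ji) scale0r.
  by move=> x; rewrite {1}Ab => -[c xc]; exists c; rewrite /= xc subrr.
move=> [v [Av iv sv]]; exists v; split=> //.
apply/seteqP; split=> x /=; last by move=> [c ->]; exact: subspace_sum.
by move=> /sv[c /eqP]; rewrite subr_eq0 => /eqP xc; exists c.
Qed.

Lemma reldim_has_codim B n : has_codim B n <-> reldim [set: V] B n.
Proof.
split=> [[b [ib sb]]|[b [_ ib sb]]]; exists b; split=> //.
by move=> x; exact: (sb x I).
Qed.

(** Steinitz exchange modulo [B]: with more vectors [v i] than [w j], the matrix
    expressing the [v i] through the [w j] modulo [B] has a nonzero row kernel,
    and a vector of this kernel is a dependence relation modulo [B]. *)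
Lemma independent_le_spanning A B n m (v : 'I_n -> V) (w : 'I_m -> V) :
  subspace B -> (forall i, A (v i)) -> independent_mod B v ->
  spanning_mod A B w -> (n <= m)%N.
Proof.
move=> sB Av iv sw; have [c cP] := choice (fun i => sw (v i) (Av i)).
pose M : 'M[K]_(n, m) := \matrix_(i, j) c i j.
rewrite leqNgt; apply/negP => mn.
have : kermx M != 0.
  by rewrite -mxrank_eq0 mxrank_ker -lt0n subn_gt0;
    exact: leq_ltn_trans (rank_leq_col _) mn.
move=> /rowV0Pn[u /sub_kermxP uM u0].
have Bu : B (\sum_i u 0 i *: v i).
  have -> : \sum_i u 0 i *: v i =
      \sum_i u 0 i *: (v i - \sum_j c i j *: w j).
    under [RHS]eq_bigr do rewrite scalerBr.
    rewrite sumrB [X in _ - X](_ : _ = 0) ?subr0//.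
    under eq_bigr do rewrite scaler_sumr.
    rewrite exchange_big /= big1// => j _.
    under eq_bigr do rewrite scalerA.
    rewrite -scaler_suml.
    have := congr1 (fun N : 'rV_m => N 0 j) uM; rewrite !mxE.
    by under eq_bigr do rewrite mxE; move=> ->; rewrite scale0r.
  exact: subspace_sum.
case/eqP: u0; apply/rowP => i; rewrite !mxE; exact: (iv (fun i => u 0 i) Bu).
Qed.

Lemma reldim_unique A B n m : subspace B ->
  reldim A B n -> reldim A B m -> n = m.
Proof.
move=> sB [v [Av iv sv]] [w [Aw iw sw]]; apply/eqP; rewrite eqn_leq.
by rewrite (independent_le_spanning sB Av iv sw)
           (independent_le_spanning sB Aw iw sv).
Qed.

Lemma independent_extend B n (v : 'I_n -> V) x : subspace B ->
  independent_mod B v ->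
  ~ (exists c : 'I_n -> K, B (x - \sum_i c i *: v i)) ->
  independent_mod B (cons_family x v).
Proof.
move=> sB iv nx c; rewrite big_ord_recl /cons_family unlift_none /=.
under eq_bigr do rewrite liftK /=.
move=> Bc; have [c0|c0] := eqVneq (c ord0) 0.
  move: Bc; rewrite c0 scale0r add0r => /iv c1 i.
  by case: (unliftP ord0 i) => [j ->|->//]; exact: c1.
exfalso; apply: nx; exists (fun i => - (c ord0)^-1 * c (lift ord0 i)).
have := subspaceZ (c ord0)^-1 sB Bc.
rewrite scalerDr scalerA mulVf// scale1r scaler_sumr -sumrN.
congr (B (_ + _)); apply: eq_bigr => i _.
by rewrite scalerA mulNr scaleNr opprK.
Qed.

Lemma independent_spanning A B n (v : 'I_n -> V) : subspace B ->
  (forall i, A (v i)) -> independent_mod B v -> reldim A B n ->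
  spanning_mod A B v.
Proof.
move=> sB Av iv [w [_ _ sw]] x Ax; apply: contrapT => nx.
have := independent_le_spanning sB _ (independent_extend sB iv nx) sw.
rewrite ltnn => /(_ _)/wrap[]// => i.
by rewrite /cons_family; case: unliftP => [j _|_] /=.
Qed.

(** An independent family of maximal size is spanning, since otherwise it could
    be extended; a bound on the sizes makes a maximal one exist. *)
Lemma reldim_bounded A B m : subspace B ->
  (forall n (v : 'I_n -> V),
     (forall i, A (v i)) -> independent_mod B v -> (n <= m)%N) ->
  exists n, reldim A B n.
Proof.
move=> sB bd.
pose P n := `[< exists v : 'I_n -> V,
  (forall i, A (v i)) /\ independent_mod B v >].
have P0 : exists n, P n.
  by exists 0%N; apply/asboolP; exists (fun=> 0); split=> [[]|c _ []].
have Pm n : P n -> (n <= m)%N by move=> /asboolP[v [Av iv]]; exact: (bd _ v).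
have [n /asboolP[v [Av iv]] nmax] := ex_maxnP P0 Pm.
exists n, v; split=> // x Ax; apply: contrapT => nx.
have := nmax n.+1; rewrite ltnn => /(_ _)/wrap[]//; apply/asboolP.
exists (cons_family x v); split.
  by rewrite /cons_family => i; case: unliftP => [j _|_] /=.
exact: independent_extend.
Qed.

Lemma reldim_of_spanning A B m (w : 'I_m -> V) : subspace B ->
  spanning_mod A B w -> exists n, reldim A B n.
Proof.
by move=> sB sw; apply: (@reldim_bounded _ _ m) => // n v Av iv;
  exact: independent_le_spanning iv sw.
Qed.

(** Concatenate a basis of [A] modulo [B] with one of [B] modulo [C]. *)
Lemma reldim_trans A B C n m : subspace B -> subspace C ->
  B `<=` A -> C `<=` B ->
  reldim A B n -> reldim B C m -> reldim A C (n + m).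
Proof.
move=> sB sC BA CB [v [Av iv sv]] [w [Bw iw sw]].
exists (cat_family v w).
have sumE c : \sum_(i < n + m) c i *: cat_family v w i =
    \sum_(i < n) c (lshift m i) *: v i + \sum_(i < m) c (rshift n i) *: w i.
  rewrite big_split_ord /=; congr (_ + _); apply: eq_bigr => i _.
    by rewrite cat_familyl.
  by rewrite cat_familyr.
split.
- by rewrite /cat_family => i; case: fintype.split => // j; exact: BA.
- move=> c; rewrite sumE => Cc.
  have Bc : B (\sum_(i < m) c (rshift n i) *: w i) by exact: subspace_sum.
  have cv := iv _ (_ : B (\sum_(i < n) c (lshift m i) *: v i)).
  have {}cv : forall i, c (lshift m i) = 0.
    apply: cv; rewrite -[X in B X](addrK (\sum_(i < m) c (rshift n i) *: w i)).
    by apply: subspaceB => //; exact: CB.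
  move: Cc; rewrite big1 => [|i _]; last by rewrite cv scale0r.
  rewrite add0r => /iw cw i.
  by rewrite -(splitK i); case: fintype.split => j /=.
- move=> x /sv[c /sw[d Cd]].
  exists (cat_family c d).
  rewrite sumE; move: Cd; rewrite -addrA -opprD; congr (C (_ - (_ + _))).
    by apply: eq_bigr => i _; rewrite cat_familyl.
  by apply: eq_bigr => i _; rewrite cat_familyr.
Qed.

(** Additivity read backwards: this is how the dimension counts below are
    performed. *)
Lemma reldim_split A B C n : subspace B -> subspace C ->
  B `<=` A -> C `<=` B -> reldim A C n ->
  exists m l, [/\ (m + l)%N = n, reldim A B m & reldim B C l].
Proof.
move=> sB sC BA CB AC; have [v [Av iv sv]] := AC.
have [m ABm] : exists m, reldim A B m.
  apply: (@reldim_of_spanning _ _ _ v) => // x /sv[c Cc].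
  by exists c; exact: CB.
have [l BCl] : exists l, reldim B C l.
  apply: (@reldim_of_spanning _ _ _ v) => // x Bx.
  by apply: sv; exact: BA.
exists m, l; split=> //; apply: (reldim_unique sC _ AC).
exact: reldim_trans ABm BCl.
Qed.

Lemma reldim0_sub A B : reldim A B 0 -> A `<=` B.
Proof.
by move=> [v [_ _ sv]] x /sv[c]; rewrite big_ord0 subr0.
Qed.

Lemma reldim_congr_mod A B B' n : (forall x, A x -> B x <-> B' x) ->
  subspace A -> reldim A B n -> reldim A B' n.
Proof.
move=> BB' sA [v [Av iv sv]]; exists v; split=> //.
  by move=> c Bc; apply: iv; apply/BB' => //; exact: subspace_sum.
move=> x Ax; have [c Bc] := sv x Ax; exists c; apply/BB' => //.
by apply: subspaceB => //; exact: subspace_sum.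
Qed.

End RelativeDimension.

Section Image.
Variables (K : fieldType) (V W : lmodType K) (S : {linear V -> W}).

Lemma linear_comb n (c : 'I_n -> K) (v : 'I_n -> V) :
  S (\sum_i c i *: v i) = \sum_i c i *: S (v i).
Proof. by rewrite linear_sum; apply: eq_bigr => i _; rewrite linearZ. Qed.

Lemma subspace_preimage (B : set W) : subspace B -> subspace (S @^-1` B).
Proof.
move=> [B0 lB]; split=> [|a x y Bx By] /=; first by rewrite linear0.
by rewrite linearP; exact: lB.
Qed.

Lemma subspace_image (A : set V) : subspace A -> subspace (S @` A).
Proof.
move=> [A0 lA]; split; first by exists 0 => //; rewrite linear0.
move=> a _ _ [x Ax <-] [y Ay <-]; exists (a *: x + y); first exact: lA.
by rewrite linearP.
Qed.

(** [S] identifies [A] modulo the preimage of [B] with [S A] modulo [B]; with [B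
    = 0] this is the rank theorem. *)
Lemma reldim_image (A : set V) (B : set W) n :
  reldim A (S @^-1` B) n -> reldim (S @` A) B n.
Proof.
move=> [v [Av iv sv]]; exists (S \o v); split.
- by move=> i; exists (v i).
- by move=> c; rewrite -linear_comb; exact: iv.
- by move=> _ [x /sv[c Bc] <-]; exists c; rewrite -linear_comb -linearB.
Qed.

End Image.

(** * Kernels and ranges of the powers of an operator *)

Section Powers.
Variables (K : fieldType) (V : lmodType K) (S : {linear V -> V}).

Local Notation ker n := (iter n S @^-1` [set 0]).
Local Notation ran n := (range (iter n S)).

Lemma iter_is_linear n : linear (iter n S).
Proof. by elim: n => [|n IH] a x y //; rewrite !iterS IH linearP. Qed.

HB.instance Definition _ n :=
  GRing.isLinear.Build K V V *:%R (iter n S) (iter_is_linear n).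

Lemma subspace_ker n : subspace (ker n).
Proof. exact: subspace_preimage (subspace0 V). Qed.

Lemma subspace_ran n : subspace (ran n).
Proof. exact: subspace_image (subspaceT V). Qed.

Lemma ker_mono m n : (m <= n)%N -> ker m `<=` ker n.
Proof.
by move=> /subnK <- x /= mx; rewrite iterD mx linear0.
Qed.

Lemma ran_anti m n : (m <= n)%N -> ran n `<=` ran m.
Proof.
move=> /subnKC <- _ [x _ <-]; rewrite iterD; exists (iter (n - m) S x) => //.
Qed.

(** [S^n] embeds [ker S^(n+1) / ker S^n] in [ker S]. *)
Lemma ker_finite n k : reldim (ker 1) [set 0] k ->
  exists d, reldim (ker n) [set 0] d.
Proof.
move=> kerk; elim: n => [|n [d IH]].
  exists 0%N, (fun=> 0); split=> [[]//|c _ []//|x /= ->].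
  by exists (fun=> 0); rewrite big_ord0 subr0.
have [m km] : exists m, reldim (ker n.+1) (ker n) m.
  apply: (@reldim_bounded _ _ _ _ k); first exact: subspace_ker.
  move=> m v kv iv; have [w [kw iw sw]] := kerk.
  apply: (independent_le_spanning (v := iter n S \o v) (subspace0 V) _ _ sw).
    by move=> i; have := kv i.
  move=> c; rewrite -(linear_comb (iter n S)); exact: iv.
exists (m + d)%N.
apply: (reldim_trans (subspace_ker n) (subspace0 V) _ _ km IH).
  exact: ker_mono.
exact: (subspace_ge0 (subspace_ker n)).
Qed.

(** [S^n] maps a complement of the range of [S] onto a set that generates [ran
    S^n] modulo [ran S^(n+1)]. *)
Lemma ran_finite n k : reldim setT (ran 1) k ->
  exists d, reldim setT (ran n) d.
Proof.
move=> [b [_ _ sb]]; elim: n => [|n [d IH]].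
  exists 0%N, (fun=> 0); split=> [//|c _ []//|x _].
  by exists (fun=> 0); exists (x - \sum_(i < 0) 0 *: 0).
have [m rm] : exists m, reldim (ran n) (ran n.+1) m.
  apply: (@reldim_of_spanning _ _ _ _ _ (iter n S \o b)).
    exact: subspace_ran.
  move=> _ [x _ <-]; have [c [y _ /= yE]] := sb x I.
  exists c; exists y => //; rewrite -(linear_comb (iter n S)) -linearB -yE.
  exact: (iterSr n S y).
exists (d + m)%N.
by apply: (reldim_trans (subspace_ran n) (subspace_ran n.+1) _ _ IH rm) => //;
  exact: ran_anti.
Qed.

Lemma ker_stable p n : ker p = ker p.+1 -> ker (n + p) `<=` ker p.
Proof.
move=> kp; elim: n => // n IH x kx; apply: IH.
have : ker p.+1 (iter n S x).
  rewrite /preimage /= -[S _]/(iter p.+1 S (iter n S x)) -iterD addSn addnC.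
  exact: kx.
by rewrite -kp /preimage /= -iterD addnC.
Qed.

Lemma ran_stable q n : ran q = ran q.+1 -> ran q `<=` ran (n + q).
Proof.
move=> rq; elim: n => // n IH x /IH[y _ <-].
have : ran q (iter q S y) by exists y.
by rewrite iterD rq => -[z _ <-]; exists z => //; rewrite -iterD addnS.
Qed.

(** Let [K = ker S^p]. Since [S] acts on the finite-dimensional space [K], the
    rank theorem gives [dim (K / S K) = dim (ker S)]. Stability of the kernels
    gives [K `&` range S = S K], for [S y] in [K] means [y] in [ker S^(p+1)]. *)
Lemma stable_ker_mod_ran p k : ker p = ker p.+1 -> reldim (ker 1) [set 0] k ->
  reldim (ker p) (range S) k.
Proof.
move=> kp k1; have [d kd] := ker_finite p k1.
have k1p : ker 1 `<=` ker p.
  by apply: (subset_trans (ker_mono (leq_addr p 1))); exact: ker_stable.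
have SK : S @` ker p `<=` ker p.
  by move=> _ [x /= x0 <-]; rewrite -iterSr iterS x0 linear0.
have sSK := subspace_image S (subspace_ker p).
have [e [l [eld ke kl]]] := reldim_split (subspace_ker 1) (subspace0 V)
  k1p (subspace_ge0 (subspace_ker 1)) kd.
have [e' [l' [eld' ke' kl']]] := reldim_split sSK (subspace0 V)
  SK (subspace_ge0 sSK) kd.
have lk := reldim_unique (subspace0 V) kl k1.
have le := reldim_unique (subspace0 V) kl' (reldim_image ke).
have <- : e' = k.
  by apply/eqP; rewrite -(eqn_add2r l') eld' -eld le lk addnC.
apply: (reldim_congr_mod _ (subspace_ker p) ke') => x kx; split.
  by move=> [y _ <-]; exists y.
move=> [y _ yx]; exists y => //.
by rewrite kp /=  -iterS iterSr yx.
Qed.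

(** With nullity and codimension equal, a basis of [K = ker S^p] modulo the
    range of [S] is already a basis of the whole space modulo that range. So
    every vector is in [K + range S], and applying [S^p] kills the part in [K].
    *)
Lemma stable_ker_stable_ran p k : ker p = ker p.+1 ->
  reldim (ker 1) [set 0] k -> reldim setT (range S) k -> ran p = ran p.+1.
Proof.
move=> kp k1 r1; have [v [kv iv _]] := stable_ker_mod_ran kp k1.
have sv := independent_spanning (subspace_ran 1) (fun _ => I) iv r1.
apply/seteqP; split; last exact: ran_anti.
move=> _ [x _ <-]; have [c [y _ /= Sy]] := sv x I; exists y => //.
change (iter p.+1 S y = iter p S x); rewrite iterSr Sy linearB /=.
rewrite (_ : iter p S (\sum_i _) = 0) ?subr0//.
exact: (subspace_sum _ (subspace_ker p)).
Qed.

(** For large [n] the ranges are stable, so [S^n x = S^(2n+1) y] for some [y].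
    Then [x - S^(n+1) y] is in [ker S^n = ker S^p], that is, [x] lies in [ker
    S^p + range S], and [stable_ker_mod_ran] computes the codimension. *)
Lemma codim_ran_of_stable p q k : ker p = ker p.+1 -> ran q = ran q.+1 ->
  reldim (ker 1) [set 0] k -> reldim setT (range S) k.
Proof.
move=> kp rq k1; have [v [kv iv sv]] := stable_ker_mod_ran kp k1.
exists v; split=> // x _.
pose n := (p + q)%N.
have [y _ xy] : ran (n.+1 + n) (iter n S x).
  have /ran_stable : ran q = ran q.+1 by [].
  move=> /(_ (n.+1 + p)%N); rewrite -addnA; apply.
  by apply: (ran_anti (leq_addl p q)); exists x.
have kx : ker p (x - iter n.+1 S y).
  apply: (@ker_stable p q kp); rewrite addnC -/n.
  change (iter n S (x - iter n.+1 S y) = 0).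
  rewrite linearB; apply/eqP; rewrite subr_eq0 /= -xy.
  by rewrite -[S _]/(iter n.+1 S y) -!iterD addnC.
have [c [z _ zE]] := sv _ kx; exists c; exists (z + iter n S y) => //.
by rewrite linearD zE -iterS addrAC subrK.
Qed.

(** Let [Y = ran S^q = S Y], a subspace of finite codimension. The map induced
    by [S] on the finite-dimensional quotient by [Y] has a kernel of dimension
    the codimension [k] of its range. This kernel is [(ker S + Y) / Y], because
    [S x] in [Y = S Y] puts [x] in [ker S + Y]. So [ker S / (ker S `&` Y)] has
    dimension [k = dim (ker S)], whence [ker S `&` Y = 0]. *)
Lemma ker_meet_stable_ran q k : ran q = ran q.+1 -> reldim (ker 1) [set 0] k ->
  reldim setT (range S) k -> ker 1 `&` ran q `<=` [set 0].
Proof.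
move=> rq k1 r1; have [d rd] := ran_finite q r1.
have rS : ran q `<=` range S by rewrite rq => _ [x _ <-]; exists (iter q S x).
have sP := subspace_preimage S (subspace_ran q).
have rP : ran q `<=` S @^-1` ran q.
  by move=> x [y _ <-]; exists (S y) => //; rewrite -iterSr.
have [m [e [med rm re]]] := reldim_split (subspace_ran 1) (subspace_ran q)
  (@subsetT _ _) rS rd.
have [e' [g [eg re' rg]]] := reldim_split sP (subspace_ran q)
  (@subsetT _ _) rP rd.
have mk := reldim_unique (subspace_ran 1) rm r1.
have ee := reldim_unique (subspace_ran q) (reldim_image re') re.
(* The kernel of the map induced by [S] on the quotient by [ran q]. *)
have {g eg rg}rg : reldim (S @^-1` ran q) (ran q) k.
  suff -> : k = g by [].
  by apply/eqP; rewrite -(eqn_add2l e') eg -med ee mk addnC.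
have sI := subspaceI (subspace_ker 1) (subspace_ran q).
have [l [h [lh nl nh]]] := reldim_split sI (subspace0 V)
  (@subIsetl _ _ _) (subspace_ge0 sI) k1.
have nl' : reldim (ker 1) (ran q) l.
  by apply: reldim_congr_mod nl => [x kx|]; [split=> [[]|]|exact: subspace_ker].
suff hE : h = 0%N by move: nh; rewrite hE; exact: reldim0_sub.
suff lk : l = k by apply/eqP; rewrite -(eqn_add2l l) lh lk addn0.
apply: (reldim_unique (subspace_ran q) _ rg).
have [v [kv iv sv]] := nl'; exists v; split=> //.
  by move=> i; rewrite /= [S _](kv i); exact: (subspace_ran q).1.
move=> x Sx; have [y _ yE] : ran q.+1 (S x) by rewrite -rq.
have kxy : ker 1 (x - iter q S y).
  by change (S (x - iter q S y) = 0); rewrite linearB -yE subrr.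
have [c Bc] := sv _ kxy; exists c.
rewrite -[x](subrK (iter q S y)) addrAC.
by apply: (subspaceD (subspace_ran q)) => //; exists y.
Qed.

Lemma trivial_meet_ascent q : ker 1 `&` ran q `<=` [set 0] -> ker q = ker q.+1.
Proof.
move=> kr; apply/seteqP; split; first exact: ker_mono.
by move=> x Sx; apply: kr; split=> //; exists x.
Qed.

(** The dimension of [ker S `&` ran S^n] is a nonincreasing sequence of natural
    numbers; [q] is a place where it is least. *)
Lemma ker_ran_stabilizes k : reldim (ker 1) [set 0] k ->
  exists q, forall n, ker 1 `&` ran q `<=` ran n.
Proof.
move=> k1.
have sI n := subspaceI (subspace_ker 1) (subspace_ran n).
have fin n : exists h, reldim (ker 1 `&` ran n) [set 0] h.
  have [l [h [_ _]]] := reldim_split (sI n) (subspace0 V)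
    (@subIsetl _ _ _) (subspace_ge0 (sI n)) k1.
  by exists h.
pose P h := `[< exists n, reldim (ker 1 `&` ran n) [set 0] h >].
have Pex : exists h, P h.
  by have [h ?] := fin 0%N; exists h; apply/asboolP; exists 0%N.
have [h /asboolP[q qh] hmin] := ex_minnP Pex.
exists q => n x [kx rx].
have [nq|qn] := leqP n q; first exact: (ran_anti nq).
have sub : ker 1 `&` ran n `<=` ker 1 `&` ran q.
  by apply: setIS; exact/ran_anti/ltnW.
have [l [m [lm ql nm]]] :=
  reldim_split (sI n) (subspace0 V) sub (subspace_ge0 (sI n)) qh.
have hm : (h <= m)%N by apply: hmin; apply/asboolP; exists n.
have l0 : l = 0%N by apply/eqP; rewrite -leqn0 -(leq_add2r m) lm.
by move: ql; rewrite l0 => /reldim0_sub/(_ x (conj kx rx))[].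
Qed.

End Powers.

(** * Real-valued norms and summation of geometric series *)

Section RealNorm.
Variables (R : realType) (V : normedModType R[i]).
Implicit Types (x y : V).

(** The norm of an [R[i]]-normed module takes values in [R[i]], where the order
    is partial; estimates are carried out on its real part, which carries all
    the information ([nrmE]). *)
Definition nrm x : R := complex.Re `|x|.

Lemma nrmE x : `|x| = (nrm x)%:C%C.
Proof. by rewrite /nrm RRe_real// ger0_real. Qed.

Lemma nrm_ge0 x : 0 <= nrm x.
Proof. by rewrite -ler0c -nrmE. Qed.

Lemma nrm0 : nrm 0 = 0.
Proof. by rewrite /nrm normr0. Qed.

Lemma nrm_eq0 x : nrm x = 0 -> x = 0.
Proof. by move=> x0; apply/normr0_eq0; rewrite nrmE x0. Qed.

Lemma nrmN x : nrm (- x) = nrm x.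
Proof. by rewrite /nrm normrN. Qed.

Lemma nrmBC x y : nrm (x - y) = nrm (y - x).
Proof. by rewrite -nrmN opprB. Qed.

Lemma nrmD x y : nrm (x + y) <= nrm x + nrm y.
Proof. by rewrite -lecR rmorphD /= -!nrmE ler_normD. Qed.

Lemma nrmB x y : nrm (x - y) <= nrm x + nrm y.
Proof. by rewrite -(nrmN y) nrmD. Qed.

Lemma nrm_tri x y z : nrm (x - z) <= nrm (x - y) + nrm (y - z).
Proof. by rewrite (le_trans _ (nrmD _ _))// addrA subrK. Qed.

Lemma nrmZ (a : R[i]) x : nrm (a *: x) = Normc.normc a * nrm x.
Proof.
apply: complexI; rewrite -nrmE normrZ rmorphM /= -nrmE.
by congr (_ * _).
Qed.

Lemma nrm_sum (I : Type) (r : seq I) (F : I -> V) :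
  nrm (\sum_(i <- r) F i) <= \sum_(i <- r) nrm (F i).
Proof.
elim/big_ind2: _ => [|x a y b xa yb|//]; first by rewrite nrm0.
by rewrite (le_trans (nrmD _ _))// lerD.
Qed.

End RealNorm.

Section Normc.
Variable (R : realType).
Local Notation normc := Normc.normc.
Implicit Types z w : R[i].

Lemma normc_norm z : `|z| = (normc z)%:C%C. Proof. by []. Qed.

Lemma normc_ge0 z : 0 <= normc z.
Proof. by rewrite -ler0c -normc_norm. Qed.

Lemma normcX z n : normc (z ^+ n) = normc z ^+ n.
Proof.
by apply: complexI; rewrite rmorphXn /= -!normc_norm normrX.
Qed.

Lemma normcR (a : R) : 0 <= a -> normc a%:C%C = a.
Proof.
by move=> a0; apply: complexI; rewrite -normc_norm ger0_norm// ler0c.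
Qed.

Lemma normc_nat n : normc n%:R = n%:R :> R.
Proof.
by apply: complexI; rewrite -normc_norm normr_nat rmorph_nat.
Qed.

End Normc.

Section Bounded.
Variables (R : realType) (V W : normedModType R[i]).

Lemma bounded_map_nrm (f : V -> W) : bounded_map f ->
  exists2 M : R, 0 <= M & forall x, nrm (f x) <= M * nrm x.
Proof.
move=> /bounded_map_ge0[M M0 fM].
exists (complex.Re M); first by rewrite -ler0c RRe_real ?ger0_real.
move=> x; rewrite -lecR rmorphM /= -!nrmE RRe_real ?ger0_real//.
Qed.

End Bounded.

(** Passage to the limit in inequalities along geometrically convergent
    approximations. *)
Lemma le_geo (R : realType) (a b D : R) :
  (forall n, a <= b + D / 2 ^+ n) -> a <= b.
Proof.
move=> h; rewrite leNgt; apply/negP => ba.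
pose n := (Num.truncn (D / (a - b))).+1.
have ab : 0 < a - b by lra.
have Dn : D / (a - b) < n%:R by rewrite truncnS_gt.
have n2 : n%:R <= 2 ^+ n :> R by rewrite -natrX ler_nat ltnW// ltn_expl.
have p2 : 0 < 2 ^+ n :> R by rewrite exprn_gt0.
have := h n; rewrite -lerBlDl ler_pdivlMr// => ?.
move: Dn; rewrite ltr_pdivrMr// => ?.
have : n%:R * (a - b) <= 2 ^+ n * (a - b) by rewrite ler_pM2r.
lra.
Qed.

Section GeoComplete.
Variables (R : realType) (V : normedModType R[i]).

(** Completeness in the only form used below: series dominated by a geometric
    series of ratio 1/2 converge, with the natural bound on the remainder.
    Unlike completeness in terms of filters it is easily proved for the dual of
    a normed space. *)
Definition geo_complete : Prop :=
  forall (u : nat -> V) (C : R), (forall n, nrm (u n) <= C / 2 ^+ n) ->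
  exists s, forall n, nrm (s - \sum_(k < n) u k) <= 2 * C / 2 ^+ n.

Lemma geo_partial (u : nat -> V) (C : R) (n m : nat) :
  (forall n, nrm (u n) <= C / 2 ^+ n) ->
  nrm (\sum_(k < n + m) u k - \sum_(k < n) u k) <= 2 * C / 2 ^+ n.
Proof.
move=> uC; have C0 : 0 <= C.
  by have := uC 0%N; rewrite expr0 divr1; apply: le_trans; exact: nrm_ge0.
suff : nrm (\sum_(k < n + m) u k - \sum_(k < n) u k) <=
    2 * C / 2 ^+ n - 2 * C / 2 ^+ (n + m).
  move=> /le_trans; apply; rewrite lerBlDr lerDl.
  by rewrite divr_ge0 ?exprn_ge0 ?mulr_ge0.
elim: m => [|m IH]; first by rewrite addn0 !subrr nrm0.
rewrite addnS big_ord_recr /= addrAC (le_trans (nrmD _ _))//.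
have := uC (n + m)%N.
have -> : 2 * C / 2 ^+ (n + m).+1 = C / 2 ^+ (n + m).
  by rewrite exprS invfM mulrACA divff ?mul1r.
move: IH; rewrite -!mulrA; lra.
Qed.

End GeoComplete.

Lemma complete_geo_complete (R : realType) (V : completeNormedModType R[i]) :
  @geo_complete R V.
Proof.
move=> u C uC.
pose P n := \sum_(k < n) u k.
have C0 : 0 <= C.
  by have := uC 0%N; rewrite expr0 divr1; apply: le_trans; exact: nrm_ge0.
have Pc : cvg (P @ \oo).
  apply/cauchy_cvgP/cauchy_exP => e e0.
  have eR : e = (complex.Re e)%:C%C by rewrite RRe_real// gtr0_real.
  have e0' : 0 < complex.Re e by rewrite -ltcR -eR.
  have [n nP] : exists n, 2 * C / 2 ^+ n < complex.Re e.
    apply: contrapT => /forallNP h.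
    suff : complex.Re e <= 0 by lra.
    by apply: (@le_geo _ _ _ (2 * C)) => n; rewrite add0r leNgt; apply/negP.
  exists (P n); exists n => // m /= nm.
  rewrite -ball_normE /= eR nrmE ltcR (le_lt_trans _ nP)//.
  by rewrite nrmBC -(subnKC nm); exact: geo_partial.
exists (lim (P @ \oo)) => n.
have /cvgrPdist_le Pl := Pc.
apply/ler_addgt0Pr => e e0.
have e0' : 0 < e%:C%C :> R[i] by rewrite ltcR.
have [N _ NP] := Pl _ e0'.
have := NP (n + N)%N; rewrite /= leq_addl nrmE lecR => /(_ isT) h.
rewrite (le_trans (nrm_tri _ (P (n + N)%N) _))// addrC lerD//.
exact: geo_partial.
Qed.

Section ScalarsComplete.
Variable R : realType.

(** The limit is the supremum of the lower bounds [P n - d n], which lie below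
    all the upper bounds [P m + d m]; this gives the remainder bounds without
    loss. *)
Lemma real_cauchy_limit (P d : nat -> R) :
  (forall n m, `|P (n + m)%N - P n| <= d n) ->
  exists s, forall n, `|s - P n| <= d n.
Proof.
move=> Pd.
have low n m : P n - d n <= P m + d m.
  have d0 k : 0 <= d k by exact: le_trans (Pd k 0%N).
  have [nm|/ltnW mn] := leqP n m.
    have := Pd n (m - n)%N; rewrite subnKC// ler_norml => /andP[].
    have := d0 m; lra.
  have := Pd m (n - m)%N; rewrite subnKC// ler_norml => /andP[].
  have := d0 n; lra.
pose E := range (fun n => P n - d n).
have supE : has_sup E.
  split; first by exists (P 0%N - d 0%N); exists 0%N.
  by exists (P 0%N + d 0%N) => _ [n _ <-]; exact: low.
exists (sup E) => n; rewrite ler_norml; apply/andP; split.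
  have : P n - d n <= sup E by apply: ub_le_sup; [case: supE|exists n].
  lra.
have : sup E <= P n + d n.
  by apply: ge_sup; [case: supE|move=> _ [m _ <-]; exact: low].
lra.
Qed.

(** Any geometric estimate of the remainder can be replaced by the optimal one:
    a limit obtained coordinatewise only comes with a larger constant. *)
Lemma geo_sharpen (V : normedModType R[i]) (u : nat -> V) (C D : R) s :
  (forall n, nrm (u n) <= C / 2 ^+ n) ->
  (forall n, nrm (s - \sum_(k < n) u k) <= D / 2 ^+ n) ->
  forall n, nrm (s - \sum_(k < n) u k) <= 2 * C / 2 ^+ n.
Proof.
move=> uC sD n; apply: (@le_geo _ _ _ D) => m.
rewrite (le_trans (nrm_tri _ (\sum_(k < n + m) u k) _))// addrC lerD//.
  exact: geo_partial.
rewrite (le_trans (sD _))// ler_wpM2l ?lef_pV2 ?posrE ?exprn_gt0//.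
  by have := le_trans (nrm_ge0 _) (sD 0%N); rewrite expr0 divr1.
by rewrite ler_weXn2l ?leq_addl ?ler1n.
Qed.

Lemma nrm_le_ReIm (z : R[i]^o) : nrm z <= `|complex.Re z| + `|complex.Im z|.
Proof.
have -> : nrm z =
    nrm ((complex.Re z)%:C%C + 'i%C * (complex.Im z)%:C%C : R[i]^o).
  by congr nrm; exact: complexE.
rewrite (le_trans (@nrmD R R[i]^o _ _))// lerD//.
  by rewrite /nrm normc_norm /= expr0n addr0 sqrtr_sqr.
by rewrite /nrm normc_norm /= !mul0r !mul1r subrr add0r expr0n add0r sqrtr_sqr.
Qed.

Lemma nrm_ge_Re (z : R[i]^o) : `|complex.Re z| <= nrm z.
Proof. by rewrite -lecR -nrmE normc_ge_Re. Qed.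

Lemma nrm_ge_Im (z : R[i]^o) : `|complex.Im z| <= nrm z.
Proof.
rewrite /nrm normc_norm /=; case: z => a b /=.
by rewrite -sqrtr_sqr ler_wsqrtr// lerDr sqr_ge0.
Qed.

Lemma complex_geo_complete : @geo_complete R R[i]^o.
Proof.
move=> u C uC; pose P n : R[i] := \sum_(k < n) u k.
have PC n m : nrm (P (n + m)%N - P n : R[i]^o) <= 2 * C / 2 ^+ n.
  exact: geo_partial.
have RePC n m :
    `|complex.Re (P (n + m)%N) - complex.Re (P n)| <= 2 * C / 2 ^+ n.
  by apply: le_trans (PC n m); rewrite -raddfB nrm_ge_Re.
have ImPC n m :
    `|complex.Im (P (n + m)%N) - complex.Im (P n)| <= 2 * C / 2 ^+ n.
  by apply: le_trans (PC n m); rewrite -raddfB nrm_ge_Im.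
have [a aP] := real_cauchy_limit RePC; have [b bP] := real_cauchy_limit ImPC.
exists (Complex a b); apply: (@geo_sharpen _ _ _ (4 * C)) => // n.
rewrite (le_trans (nrm_le_ReIm _))// !raddfB /=.
have := aP n; have := bP n; rewrite /P -!mulrA; lra.
Qed.

End ScalarsComplete.

(** * The dual space *)

Section DualComplete.
Variables (R : realType) (X : normedModType R[i]).
Local Notation C := (R[i]^o).

Lemma nrm_dual_le (f : dual X) x : nrm (f x : C) <= nrm f * nrm x.
Proof. by rewrite -lecR rmorphM /= -!nrmE; exact: dual_norm_le. Qed.

Lemma nrm_dual_ub (f : dual X) (M : R) : 0 <= M ->
  (forall x, nrm (f x : C) <= M * nrm x) -> nrm f <= M.
Proof.
move=> M0 fM; rewrite -lecR -nrmE; apply: dual_norm_ub; first by rewrite lecR.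
by move=> x; rewrite !nrmE -rmorphM lecR.
Qed.

Lemma dual_sumE (n : nat) (f : 'I_n -> dual X) x :
  (\sum_i f i) x = \sum_i f i x :> C.
Proof.
elim/big_ind2: _ => [|g a h b ga hb|//]; first by [].
by rewrite -ga -hb.
Qed.

Lemma dual_of (g : X -> C) (M : R) : linear g ->
  (forall x, nrm (g x) <= M * nrm x) -> exists f : dual X, forall x, f x = g x.
Proof.
move=> lg gM; have gd : g \in @bounded_functional R X.
  apply/bounded_functionalP; split=> //; exists M%:C%C => x.
  by rewrite !nrmE -rmorphM lecR.
by exists (Dual gd).
Qed.

(** The sum is taken pointwise; the estimates at each point are proportional to
    the norm of the point, hence are estimates for the norm of functionals. *)
Lemma dual_geo_complete : @geo_complete R (dual X).
Proof.
move=> u A uA.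
have A0 : 0 <= A.
  by have := uA 0%N; rewrite expr0 divr1; apply: le_trans; exact: nrm_ge0.
have uxA x n : nrm (u n x : C) <= A * nrm x / 2 ^+ n.
  by rewrite (le_trans (nrm_dual_le _ _))// mulrAC ler_wpM2r ?nrm_ge0.
have [g gP] := choice (fun x => complex_geo_complete (uxA x)).
have lg : linear (g : X -> C).
  move=> a x y; apply/eqP; rewrite -subr_eq0; apply/eqP/(@nrm_eq0 R C)/le_anti.
  rewrite nrm_ge0 andbT.
  apply: (@le_geo _ _ _ (2 * (A * nrm (a *: x + y)) +
     Normc.normc a * (2 * (A * nrm x)) + 2 * (A * nrm y))) => n.
  have := gP (a *: x + y) n; have := gP x n; have := gP y n.
  set sy := \sum_(k < n) u k y; set sx := \sum_(k < n) u k x.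
  have -> : \sum_(k < n) u k (a *: x + y) = a *: (sx : C) + sy.
    rewrite scaler_sumr -big_split /=; apply: eq_bigr => k _.
    exact: dual_linear.
  move=> hy hx hxy.
  have -> : g (a *: x + y) - (a *: g x + g y) =
     (g (a *: x + y) - (a *: (sx : C) + sy)) - (a *: (g x - sx) + (g y - sy)).
    rewrite scalerBr !opprD !opprK /GRing.scale /=; ring.
  rewrite (le_trans (nrmB _ _))// add0r -addrA mulrDl lerD//.
  rewrite (le_trans (nrmD _ _))// mulrDl lerD// nrmZ -mulrA ler_wpM2l//.
  exact: normc_ge0.
have gB n x : nrm (g x - \sum_(k < n) u k x) <= 2 * A / 2 ^+ n * nrm x.
  by rewrite mulrAC -[2 * A * _]mulrA; exact: gP.
have [s sE] : exists s : dual X, forall x, s x = g x.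
  apply: (@dual_of g (2 * A)) => // x.
  by have := gB 0%N x; rewrite big_ord0 subr0 expr0 divr1.
exists s => n; apply: nrm_dual_ub.
  by rewrite divr_ge0 ?exprn_ge0 ?mulr_ge0.
move=> x; have := gB n x.
by rewrite -dual_sumE -sE.
Qed.

End DualComplete.

(** * The category argument and bounded lifts *)

Section Baire.
Variables (R : realType) (V : normedModType R[i]).
Hypothesis Vc : @geo_complete R V.

(** The Baire category theorem for a countable cover: some [E m] is dense in a
    ball. Otherwise there are nested balls of radii [r n], at least halved at
    each step, the ball of index [n.+1] avoiding [E n]; their common point would
    belong to no [E m]. *)
Lemma baire_cover (E : nat -> set V) : (forall x, exists m, E m x) ->
  exists m v0 (e : R), 0 < e /\ forall v, nrm (v - v0) <= e ->
    forall d, 0 < d -> exists2 w, E m w & nrm (v - w) <= d.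
Proof.
move=> Ecov; apply: contrapT => nE.
have step (a : nat * (V * R)) : exists b : V * R, 0 < a.2.2 ->
    [/\ nrm (b.1 - a.2.1) <= a.2.2 / 2, 0 < b.2, b.2 <= a.2.2 / 2 &
        forall w, E a.1 w -> b.2 < nrm (b.1 - w)].
  case: a => m [v0 r] /=; have [r0|] := ltP 0 r; last first.
    by exists (0, 0) => r0; lra.
  have r2 : 0 < r / 2 by lra.
  have : exists v d, [/\ nrm (v - v0) <= r / 2, 0 < d &
      forall w, E m w -> d < nrm (v - w)].
    apply: contrapT => h; apply: nE.
    exists m, v0, (r / 2); split=> // v vv0 d d0.
    apply: contrapT => h2; apply: h; exists v, d; split=> // w Ew.
    by rewrite ltNge; apply/negP => vw; apply: h2; exists w.
  move=> [v [d [vv0 d0 vE]]]; exists (v, Num.min d (r / 2)) => _ /=; split=> //.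
  - by rewrite lt_min d0.
  - by rewrite ge_min lexx orbT.
  - by move=> w Ew; rewrite (le_lt_trans _ (vE w Ew))// ge_min lexx.
have [f fP] := choice step.
pose fix p n : V * R := if n is m.+1 then f (m, p m) else (0, 1).
(* Centres and radii. *)
pose v n := (p n).1; pose r n := (p n).2.
have r_gt0 n : 0 < r n.
  elim: n => [|n IH]; first by rewrite /r /= ltr01.
  by have [] := fP (n, p n) IH.
have vP n : nrm (v n.+1 - v n) <= r n / 2 by have [] := fP (n, p n) (r_gt0 n).
have rP n : r n.+1 <= r n / 2 by have [] := fP (n, p n) (r_gt0 n).
have EP n w : E n w -> r n.+1 < nrm (v n.+1 - w).
  by have [_ _ _] := fP (n, p n) (r_gt0 n); apply.
have rgeo n : r n <= 1 / 2 ^+ n.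
  elim: n => [|n IH]; first by rewrite /r /= expr0 divr1.
  by rewrite (le_trans (rP n))// exprSr invfM mulrA ler_wpM2r.
have vgeo n : nrm (v n.+1 - v n) <= 2^-1 / 2 ^+ n.
  rewrite (le_trans (vP n))// mulrC ler_wpM2l//.
  by rewrite (le_trans (rgeo n)) ?mul1r.
have [s sP] := Vc vgeo.
have {}sP n : nrm (s - v n) <= 1 / 2 ^+ n.
  have := sP n; rewrite mulfV//.
  by rewrite -(big_mkord xpredT (fun k => v k.+1 - v k)) telescope_sumr// subr0.
(* Later centres stay in the earlier balls. *)
have vr n m : nrm (v (n + m)%N - v n) <= r n - r (n + m)%N.
  elim: m => [|m IH]; first by rewrite addn0 !subrr nrm0.
  rewrite addnS (le_trans (nrm_tri _ (v (n + m)%N) _))//.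
  have := vP (n + m)%N; have := rP (n + m)%N; move: IH; lra.
have [m Em] := Ecov s.
have := EP _ _ Em; rewrite ltNge => /negP; apply.
rewrite nrmBC; apply: (@le_geo _ _ _ 1) => k.
rewrite (le_trans (nrm_tri _ (v (m.+1 + k)%N) _))// addrC lerD//.
  by rewrite (le_trans (vr _ _))// lerBlDr lerDl ltW.
rewrite (le_trans (sP _))// ler_wpM2l ?lef_pV2 ?posrE ?exprn_gt0//.
by rewrite ler_weXn2l ?leq_addl ?ler1n.
Qed.

End Baire.

Section OpenMapping.
Variables (R : realType) (V : normedModType R[i]).
Hypothesis Vc : @geo_complete R V.
Variables (A : {linear V -> V}) (M : R) (M0 : 0 <= M).
Hypothesis AM : forall x, nrm (A x) <= M * nrm x.
Variables (k : nat) (b : 'I_k -> V).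
Hypothesis sb : spanning_mod [set: V] (range A) b.
Local Notation normc := Normc.normc.

Local Notation comb c := (\sum_(i < k) c i *: b i).

(** First half of the open mapping argument. The sets [E m] of the [A x + comb
    c] with [x] and [c] bounded by [m] cover the space, so some [E m] is dense
    in a ball around some [v0]; the difference of approximations of [v0 + t v]
    and [v0] approximates [t v], with bounded data. *)
Lemma approximate_lift : exists2 D : R, 0 <= D & forall v,
  exists x, exists c : 'I_k -> R[i],
    [/\ nrm (v - (A x + comb c)) <= nrm v / 2, nrm x <= D * nrm v &
        forall i, normc (c i) <= D * nrm v].
Proof.
pose E (m : nat) := [set w | exists x, exists c : 'I_k -> R[i],
  [/\ w = A x + comb c, nrm x <= m%:R & forall i, normc (c i) <= m%:R]].
have Ecov v : exists m, E m v.
  have [c [x _ xE]] := sb I (x := v).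
  have S0 : 0 <= \sum_i normc (c i) by apply: sumr_ge0 => i _; exact: normc_ge0.
  pose m := (Num.truncn (nrm x + \sum_i normc (c i))).+1.
  have mP : nrm x + \sum_i normc (c i) <= m%:R by rewrite ltW ?truncnS_gt.
  exists m, x, c; split; first by rewrite xE subrK.
    by move: mP; lra.
  move=> i; apply: le_trans mP; rewrite (bigD1 i)//= addrCA lerDl.
  by rewrite addr_ge0 ?nrm_ge0// sumr_ge0// => j _; exact: normc_ge0.
have [m [v0 [e [e0 eP]]]] := baire_cover Vc Ecov.
exists (2 * m%:R / e); first by rewrite divr_ge0 ?mulr_ge0 ?ler0n// ltW.
move=> v; have [->|v_neq0] := eqVneq v 0.
  exists 0, (fun=> 0); rewrite nrm0 !mulr0 mul0r; split.
  - by rewrite linear0 big1 ?addr0 ?subr0 ?nrm0// => i _; rewrite scale0r.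
  - by [].
  - by move=> i; rewrite Normc.normc0.
have nv : 0 < nrm v.
  rewrite lt_neqAle nrm_ge0 andbT eq_sym; apply/eqP => /nrm_eq0.
  exact/eqP.
(* Rescale [v] to the radius [e] of the ball. *)
pose t := e / nrm v; have t0 : 0 < t by rewrite divr_gt0.
have tc : (t%:C%C)^-1 = (t^-1)%:C%C by rewrite fmorphV.
have tnz : t%:C%C != 0 :> R[i] by rewrite fmorph_eq0 gt_eqF.
have d0 : 0 < e / 4 by lra.
have [w1 [x1 [c1 [w1E x1m c1m]]] w1P] : exists2 w, E m w &
    nrm (v0 + t%:C%C *: v - w) <= e / 4.
  apply: eP => //; rewrite addrC addKr nrmZ normcR ?(ltW t0)//.
  by rewrite /t divfK ?gt_eqF.
have [w2 [x2 [c2 [w2E x2m c2m]]] w2P] :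
    exists2 w, E m w & nrm (v0 - w) <= e / 4.
  by apply: eP => //; rewrite subrr nrm0 ltW.
have tV : t^-1 = nrm v / e by rewrite /t invf_div.
exists ((t^-1)%:C%C *: (x1 - x2)), (fun i => (t^-1)%:C%C * (c1 i - c2 i)).
split.
- have -> : v - (A ((t^-1)%:C%C *: (x1 - x2)) +
      \sum_i ((t^-1)%:C%C * (c1 i - c2 i)) *: b i) =
      (t^-1)%:C%C *: ((v0 + t%:C%C *: v - w1) - (v0 - w2)).
    rewrite w1E w2E linearZ /= linearB.
    have -> : \sum_i ((t^-1)%:C%C * (c1 i - c2 i)) *: b i =
        (t^-1)%:C%C *: (comb c1 - comb c2).
      rewrite -sumrB scaler_sumr; apply: eq_bigr => i _.
      by rewrite -scalerBl scalerA.
    rewrite -scalerDr.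
    have -> : v0 + t%:C%C *: v - (A x1 + comb c1) - (v0 - (A x2 + comb c2)) =
       t%:C%C *: v - (A x1 - A x2 + (comb c1 - comb c2)).
      have -> : A x1 - A x2 + (comb c1 - comb c2) =
          A x1 + comb c1 - (A x2 + comb c2) by rewrite opprD addrACA.
      move: (A x1 + _) (A x2 + _) => P Q.
      rewrite !opprB [v0 + _]addrC -!addrA; congr (_ + _).
      by rewrite addrCA [v0 + _]addrC subrK addrC.
    by rewrite scalerBr scalerA -tc mulVf// scale1r.
  rewrite nrmZ normcR ?invr_ge0 ?(ltW t0)// tV mulrAC ler_pdivrMr//.
  rewrite -mulrA ler_wpM2l ?(ltW nv)//.
  by rewrite (le_trans (nrmB _ _))//; move: w1P w2P; lra.
- rewrite nrmZ normcR ?invr_ge0 ?(ltW t0)// tV [_ / e * nrm v]mulrAC.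
  rewrite [nrm v / e * _]mulrAC ler_wpM2r ?invr_ge0 ?(ltW e0)// mulrC.
  by rewrite ler_wpM2r ?(ltW nv)// (le_trans (nrmB _ _))//; lra.
- move=> i; rewrite Normc.normcM normcR ?invr_ge0 ?(ltW t0)// tV.
  rewrite [_ / e * nrm v]mulrAC.
  rewrite [nrm v / e * _]mulrAC ler_wpM2r ?invr_ge0 ?(ltW e0)// mulrC.
  rewrite ler_wpM2r ?(ltW nv)// (le_trans (@nrmB R R[i]^o _ _))//.
  by have := c1m i; have := c2m i; rewrite /nrm !normc_norm /=; lra.
Qed.

(** Second half: correct the error of [approximate_lift] again and again. The
    errors are halved at each step, so the corrections sum up, in the space for
    the [x] and in the scalars for the coefficients. *)
Lemma bounded_decomposition : exists2 D : R, 0 <= D & forall v,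
  exists x, exists c : 'I_k -> R[i],
    [/\ v = A x + comb c, nrm x <= D * nrm v &
        forall i, normc (c i) <= D * nrm v].
Proof.
have [D D0 lift] := approximate_lift.
have [x xP] := choice lift; have [c cP] := choice xP.
exists (2 * D); first by rewrite mulr_ge0.
(* The error that remains after [n] corrections. *)
move=> v; pose w n := iter n (fun v => v - (A (x v) + comb (c v))) v.
have wgeo n : nrm (w n) <= nrm v / 2 ^+ n.
  elim: n => [|n IH]; first by rewrite expr0 divr1.
  have [+ _ _] := cP (w n); move/le_trans; apply.
  by rewrite exprSr invfM mulrA ler_wpM2r.
have xgeo n : nrm (x (w n)) <= (D * nrm v) / 2 ^+ n.
  have [_ + _] := cP (w n); move/le_trans; apply.
  by rewrite -mulrA ler_wpM2l.
have cgeo i n : nrm (c (w n) i : R[i]^o) <= (D * nrm v) / 2 ^+ n.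
  have [_ _ /(_ i)] := cP (w n); move/le_trans; apply.
  by rewrite -mulrA ler_wpM2l.
have [s sP] := Vc xgeo.
have [d dP] := choice (fun i => complex_geo_complete (cgeo i)).
exists s, d; split; last first.
- by move=> i; have := dP i 0%N; rewrite big_ord0 subr0 expr0 divr1 mulrA.
- by have := sP 0%N; rewrite big_ord0 subr0 expr0 divr1 mulrA.
(* The corrections made so far account for [v - w n]. *)
have wE n : v - w n = A (\sum_(j < n) x (w j)) +
    \sum_i (\sum_(j < n) c (w j) i) *: b i.
  elim: n => [|n IH].
    rewrite subrr big_ord0 linear0 big1 ?addr0// => i _.
    by rewrite big_ord0 scale0r.
  rewrite {1}/w iterS -/(w n) opprB addrCA addrC IH big_ord_recr linearD /=.
  rewrite addrACA; congr (_ + _).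
  by rewrite -big_split; apply: eq_bigr => i _; rewrite big_ord_recr scalerDl.
apply/eqP; rewrite -subr_eq0; apply/eqP/nrm_eq0/le_anti; rewrite nrm_ge0 andbT.
pose N := \sum_i nrm (b i).
apply: (@le_geo _ _ _
  (nrm v + M * (2 * (D * nrm v)) + (2 * (D * nrm v)) * N)) => n.
rewrite add0r.
have -> : v - (A s + comb d) = w n - A (s - \sum_(j < n) x (w j)) -
    \sum_i (d i - \sum_(j < n) c (w j) i) *: b i.
  have -> : \sum_i (d i - \sum_(j < n) c (w j) i) *: b i =
      comb d - \sum_i (\sum_(j < n) c (w j) i) *: b i.
    by rewrite -sumrB; apply: eq_bigr => i _; rewrite scalerBl.
  have swap (p q a c' : V) : p + q - (a + c') = - (a - p) - (c' - q).
    by rewrite !opprB opprD addrACA.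
  rewrite -{1}[v](subrK (w n)) wE [_ + w n]addrC -addrA swap addrA.
  by rewrite (linearB A).
rewrite (le_trans (nrmB _ _))// mulrDl lerD//.
  rewrite (le_trans (nrmB _ _))// mulrDl lerD//.
  by rewrite (le_trans (AM _))// -mulrA ler_wpM2l.
rewrite (le_trans (nrm_sum _ _))// mulrAC mulr_sumr ler_sum// => i _.
by rewrite nrmZ ler_wpM2r ?nrm_ge0//; exact: dP.
Qed.

End OpenMapping.

(** * Analyticity of power series *)

Section PowerSeries.
Variables (R : realType) (W : normedModType R[i]).
Local Notation normc := Normc.normc.

(** The Taylor remainder of order two of a power, with a bound that loses only a
    factor [2 ^ n]: the recurrence is [D (n+1) = (z + h) D n + n h^2 z^(n-1)],
    and [n <= 2 ^ n] absorbs the second term. *)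
Lemma power_remainder (r : R) (z h : R[i]) n : 0 < r ->
  normc z <= r -> normc (z + h) <= r ->
  normc ((z + h) ^+ n - z ^+ n - n%:R * h * z ^+ n.-1) * r ^+ 2 <=
  normc h ^+ 2 * (2 * r) ^+ n.
Proof.
move=> r0 zr zhr; elim: n => [|n IH].
  rewrite !expr0 subrr mul0r mul0r subr0 Normc.normc0 mul0r mulr1.
  by rewrite exprn_ge0 ?normc_ge0.
have -> : (z + h) ^+ n.+1 - z ^+ n.+1 - n.+1%:R * h * z ^+ n.+1.-1 =
    (z + h) * ((z + h) ^+ n - z ^+ n - n%:R * h * z ^+ n.-1) +
    n%:R * h ^+ 2 * z ^+ n.-1.
  by case: n {IH} => [|n] /=; rewrite ?exprS; ring.
set d := (z + h) ^+ n - _ - _ in IH *.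
have h0 := normc_ge0 h; have rn : 0 <= r ^+ n by rewrite exprn_ge0 ?(ltW r0).
have zn : n%:R * normc z ^+ n.-1 * r ^+ 2 <= n%:R * r ^+ n.+1.
  case: n {IH d rn} => [|n] /=; first by rewrite !mul0r.
  rewrite -mulrA ler_wpM2l// -[n.+2]addn2 exprD.
  rewrite ler_wpM2r ?exprn_ge0 ?(ltW r0)//.
  by rewrite lerXn2r ?nnegrE ?normc_ge0 ?(ltW r0).
have n2 : n%:R <= 2 ^+ n :> R by rewrite -natrX ler_nat ltnW// ltn_expl.
apply: (@le_trans _ _ (r * (normc h ^+ 2 * (2 * r) ^+ n) +
   normc h ^+ 2 * (n%:R * r ^+ n.+1))).
  rewrite (le_trans (ler_wpM2r _ (le_normcD _ _))) ?exprn_ge0 ?(ltW r0)//.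
  have -> : normc (n%:R * h ^+ 2 * z ^+ n.-1) =
      n%:R * normc h ^+ 2 * normc z ^+ n.-1.
    rewrite (Normc.normcM (n%:R * h ^+ 2)) (Normc.normcM n%:R) normc_nat.
    by rewrite !normcX.
  rewrite mulrDl Normc.normcM; apply: lerD.
    rewrite -mulrA ler_pM ?normc_ge0 ?mulr_ge0 ?normc_ge0 ?exprn_ge0
      ?(ltW r0)//.
  rewrite (_ : n%:R * _ * _ * _ =
    normc h ^+ 2 * (n%:R * normc z ^+ n.-1 * r ^+ 2)); last by ring.
  by rewrite ler_wpM2l ?exprn_ge0.
rewrite !exprMn !exprS.
have : 0 <= normc h * normc h * r * r ^+ n by rewrite !mulr_ge0// ltW.
move: n2; set p := 2 ^+ n; set m := n%:R; nra.
Qed.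

(** A first-order expansion with quadratic remainder is a derivative. *)
Lemma derivable_quadratic (f : R[i]^o -> W) (z : R[i]) (g : W) (B d : R) :
  0 < d ->
  (forall h : R[i], normc h < d ->
     nrm (f (h + z) - f z - h *: g) <= B * normc h ^+ 2) ->
  derivable f z 1.
Proof.
move=> d0 fB; apply/cvg_ex; exists g; apply/cvgrPdist_le => e e0.
have eR : e = (complex.Re e)%:C%C by rewrite RRe_real// gtr0_real.
have e0' : 0 < complex.Re e by rewrite -ltcR -eR.
pose d' := Num.min d (complex.Re e / (`|B| + 1)).
have B1 : 0 < `|B| + 1 by rewrite ltr_wpDl.
have d'0 : 0 < d' by rewrite lt_min d0 divr_gt0.
rewrite nearE /dnbhs /within /=; apply/nbhs_ballP.
exists d'%:C%C => /=; first by rewrite ltcR.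
move=> h /=; rewrite sub0r normrN normc_norm ltcR => hd h0.
have hn : 0 < normc h by rewrite -ltcR -normc_norm normr_gt0.
have hd1 : normc h < d by rewrite (lt_le_trans hd)// ge_min lexx.
have hd2 : normc h < complex.Re e / (`|B| + 1).
  by rewrite (lt_le_trans hd)// ge_min lexx orbT.
rewrite eR nrmE lecR.
have -> : g - h^-1 *: (f (h *: 1 + z) - f z) =
    - (h^-1 *: (f (h + z) - f z - h *: g)).
  by rewrite [h *: 1]mulr1 [in RHS]scalerBr scalerA mulVf// scale1r opprB.
rewrite nrmN nrmZ Normc.normcV ler_pdivrMl//.
rewrite (le_trans (fB h hd1))// mulrC expr2 -mulrA ler_wpM2l ?(ltW hn)//.
rewrite ltr_pdivlMr// in hd2.
have : B <= `|B| by rewrite ler_norm.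
nra.
Qed.

Variables (x : nat -> W) (C0 c : R) (c0 : 0 < c).
Hypothesis xc : forall n, nrm (x n) <= C0 * c ^+ n.
Hypothesis Wc : @geo_complete R W.

Let r := (4 * c)^-1.
Let r0 : 0 < r. Proof. by rewrite invr_gt0 mulr_gt0. Qed.
Let rc : 2 * r * c = 2^-1.
Proof. by rewrite /r invfM; field; rewrite gt_eqF. Qed.
Let C00 : 0 <= C0.
Proof. by have := le_trans (nrm_ge0 _) (xc 0); rewrite expr0 mulr1. Qed.

Lemma power_term (z : R[i]) n : normc z <= r ->
  nrm (z ^+ n *: x n) <= C0 / 2 ^+ n.
Proof.
move=> zr; rewrite nrmZ normcX -exprVn -rc.
rewrite mulrC (le_trans (ler_wpM2r _ (xc n))) ?exprn_ge0 ?normc_ge0//.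
rewrite -[C0 * c ^+ n * _]mulrA ler_wpM2l// -exprMn.
rewrite lerXn2r ?nnegrE ?mulr_ge0 ?normc_ge0 ?(ltW r0) ?(ltW c0)//.
rewrite [c * _]mulrC ler_wpM2r ?(ltW c0)// (le_trans zr)//.
have := r0; lra.
Qed.

(** The radius [r] is a quarter of [c^-1], so that the loss of [2 ^ n] in
    [power_remainder] and in the crude bound [n <= 2 ^ n] still leaves geometric
    series of ratio 1/2. *)
Lemma power_series_derivable (f : R[i] -> W) (z : R[i]) :
  (forall z, normc z <= r -> forall n,
     nrm (f z - \sum_(k < n) z ^+ k *: x k) <= 2 * C0 / 2 ^+ n) ->
  normc z < r -> exists g B, forall h, normc h < r - normc z ->
    nrm (f (h + z) - f z - h *: g) <= B * normc h ^+ 2.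
Proof.
move=> fP zr.
have zr' := ltW zr.
pose y k := (k%:R * z ^+ k.-1) *: x k.
(* The candidate derivative is the sum of the series of the [y k]. *)
have ygeo k : nrm (y k) <= (C0 / r) / 2 ^+ k.
  rewrite /y nrmZ Normc.normcM normc_nat normcX.
  case: k => [|k] /=.
    by rewrite !mul0r divr_ge0// divr_ge0// ltW.
  have k2 : k.+1%:R <= 2 ^+ k.+1 :> R by rewrite -natrX ler_nat ltnW// ltn_expl.
  rewrite -exprVn -rc !exprMn.
  have -> : C0 / r * (2 ^+ k.+1 * r ^+ k.+1 * c ^+ k.+1) =
     (2 ^+ k.+1 * r ^+ k) * (C0 * c ^+ k.+1).
    by rewrite [r ^+ k.+1]exprS; field; rewrite gt_eqF.
  rewrite ler_pM ?nrm_ge0 ?mulr_ge0 ?exprn_ge0 ?normc_ge0//.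
  rewrite ler_pM ?exprn_ge0 ?normc_ge0//.
  by rewrite lerXn2r ?nnegrE ?normc_ge0 ?(ltW r0).
have [g gP] := Wc ygeo.
exists g, (2 * C0 / r ^+ 2) => h hr.
have zhr : normc (z + h) <= r.
  by rewrite (le_trans (le_normcD _ _))//; lra.
pose D k := (z + h) ^+ k - z ^+ k - k%:R * h * z ^+ k.-1.
have sumE n : \sum_(k < n) (z + h) ^+ k *: x k - \sum_(k < n) z ^+ k *: x k -
    h *: \sum_(k < n) y k = \sum_(k < n) D k *: x k.
  rewrite scaler_sumr -!sumrB; apply: eq_bigr => k _.
  by rewrite /y scalerA -!scalerBl /D mulrA [h * _]mulrC.
have DP k : nrm (D k *: x k) <= (normc h ^+ 2 / r ^+ 2 * C0) / 2 ^+ k.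
  rewrite nrmZ -[(2 ^+ k)^-1]exprVn -rc exprMn.
  have := power_remainder k r0 zr' zhr.
  rewrite -/(D k) -ler_pdivlMr ?exprn_gt0//.
  move=> /(ler_pM (normc_ge0 _) (nrm_ge0 _)) /(_ (xc k)) /le_trans; apply.
  rewrite le_eqVlt; apply/orP; left; apply/eqP; ring.
have Dsum n : nrm (\sum_(k < n) D k *: x k) <= 2 * C0 / r ^+ 2 * normc h ^+ 2.
  have := @geo_partial _ _ (fun k => D k *: x k) _ 0 n DP.
  rewrite big_ord0 subr0 add0n expr0 divr1 => /le_trans; apply.
  by rewrite le_eqVlt; apply/orP; left; apply/eqP; ring.
apply: (@le_geo _ _ _ (2 * C0 + 2 * C0 + normc h * (2 * (C0 / r)))) => n.
rewrite [h + z]addrC.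
have -> : f (z + h) - f z - h *: g =
  \sum_(k < n) D k *: x k +
  ((f (z + h) - \sum_(k < n) (z + h) ^+ k *: x k) -
   (f z - \sum_(k < n) z ^+ k *: x k) - h *: (g - \sum_(k < n) y k)).
  have swap (p q s t : W) : p - q - (s - t) = p - s - (q - t).
    by rewrite !opprB addrACA [RHS]addrACA [- s - q]addrC.
  rewrite -sumE scalerBr.
  set a := \sum_(k < n) (z + h) ^+ k *: x k.
  set b := \sum_(k < n) z ^+ k *: x k; set e := h *: \sum_(k < n) y k.
  by rewrite (swap (f (z + h)) a) (swap (f (z + h) - f z)) [RHS]addrC subrK.
rewrite (le_trans (nrmD _ _))// lerD//.
rewrite (le_trans (nrmB _ _))// mulrDl lerD//.
  by rewrite (le_trans (nrmB _ _))// mulrDl lerD// fP.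
by rewrite nrmZ -mulrA ler_wpM2l ?normc_ge0.
Qed.

End PowerSeries.

(** * Single-valued extension property and ascent *)

Section Disc.
Variable R : realType.
Local Notation normc := Normc.normc.

Lemma open_disc (l : R[i]) (r : R) : open [set z : R[i]^o | normc (z - l) < r].
Proof.
have [r0|r0] := ltP 0 r; last first.
  rewrite (_ : [set z | _] = set0) ?open0//.
  apply/seteqP; split=> // z /=; have := normc_ge0 (z - l); lra.
have r0' : 0 < r%:C%C :> R[i] by rewrite ltcR.
rewrite (_ : [set z | _] = ball (l : R[i]^o) r%:C%C); first exact: ball_open.
by apply/seteqP; split=> z; rewrite -ball_normE /= distrC normc_norm ltcR.
Qed.

(** A disc is the union of the segments joining its centre to its points. *)
Lemma connected_disc (l : R[i]) (r : R) :
  connected [set z : R[i]^o | normc (z - l) < r].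
Proof.
have [r0|r0] := ltP 0 r; last first.
  rewrite (_ : [set z | _] = set0); first exact: connected0.
  apply/seteqP; split=> // z /=; have := normc_ge0 (z - l); lra.
pose seg (z : R[i]) (t : R) : R[i]^o := l + t%:C%C * (z - l).
rewrite (_ : [set z | _] =
    \bigcup_(z in [set z | normc (z - l) < r]) (seg z @` `[0, 1])).
  apply: bigcup_connected.
    exists l => z _; exists 0; first by rewrite /= in_itv /= lexx ler01.
    by rewrite /seg mul0r addr0.
  move=> z _; apply: connected_continuous_connected.
    exact: segment_connected.
  apply: continuous_subspaceT => t; apply/cvgrPdist_le => e e0.
  have eR : e = (complex.Re e)%:C%C by rewrite RRe_real// gtr0_real.
  have e0' : 0 < complex.Re e by rewrite -ltcR -eR.
  have n1 : 0 < normc (z - l) + 1 by rewrite ltr_wpDl ?normc_ge0.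
  apply/nbhs_ballP; exists (complex.Re e / (normc (z - l) + 1)).
    by rewrite /= divr_gt0.
  move=> s /=; rewrite ltr_pdivlMr// => ts.
  have -> : seg z t - seg z s = (t - s)%:C%C * (z - l).
    by rewrite /seg rmorphB /=; ring.
  rewrite normrM eR !normc_norm -rmorphM lecR /=.
  rewrite expr0n addr0 sqrtr_sqr.
  have := normr_ge0 (t - s); move: ts; have := normc_ge0 (z - l); nra.
apply/seteqP; split=> z /=.
  move=> zr; exists z => //; exists 1; first by rewrite /= in_itv /= lexx ler01.
  by rewrite /seg mul1r addrC subrK.
move=> [w /= wr [t]]; rewrite /= in_itv /= => /andP[t0 t1] <-.
rewrite /seg addrC addKr Normc.normcM normcR//.
have := normc_ge0 (w - l); nra.
Qed.

End Disc.

Section SvepAscent.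
Variables (R : realType) (W : normedModType R[i]).
Hypothesis Wc : @geo_complete R W.
Variables (T : bounded_operator W) (l : R[i]) (S : {linear W -> W}).
Hypothesis SE : forall x, S x = shift_op T l x.
Local Notation normc := Normc.normc.

Lemma shift_bounded : exists2 M : R, 0 <= M & forall x, nrm (S x) <= M * nrm x.
Proof.
have [M M0 TM] := bounded_map_nrm (bop_bounded T).
exists (M + normc l) => [|x]; first by rewrite addr_ge0 ?normc_ge0.
by rewrite SE (le_trans (nrmB _ _))// nrmZ mulrDl lerD.
Qed.

Lemma iter_bounded M n : 0 <= M -> (forall x, nrm (S x) <= M * nrm x) ->
  forall x, nrm (iter n S x) <= M ^+ n * nrm x.
Proof.
move=> M0 SM; elim: n => [|n IH] x; first by rewrite expr0 mul1r.
by rewrite iterS (le_trans (SM _))// exprS -mulrA ler_wpM2l.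
Qed.

(** The function [f z = \sum_n z^n x n] satisfies [S (f z) = z f z] because [S
    (x n.+1) = x n] and [S (x 0) = 0]. So [z |-> f (z - l)] is an analytic
    family of eigenvectors of [T] on a disc around [l]; by SVEP it vanishes, in
    particular at [l], where its value is [x 0]. *)
Lemma backward_orbit_svep (x : nat -> W) (C0 c : R) : 0 < c ->
  (forall n, nrm (x n) <= C0 * c ^+ n) ->
  S (x 0) = 0 -> (forall n, S (x n.+1) = x n) -> svep_at T l -> x 0 = 0.
Proof.
move=> c0 xc Sx0 SxS svep.
have [M M0 SM] := shift_bounded.
pose r : R := (4 * c)^-1.
have r0 : 0 < r by rewrite invr_gt0 mulr_gt0.
have sums (z : R[i]) : exists s : W, normc z <= r -> forall n,
    nrm (s - \sum_(k < n) z ^+ k *: x k) <= 2 * C0 / 2 ^+ n.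
  have [zr|zr] := boolP (normc z <= r); last by exists 0.
  by have [s sP] := Wc (fun n => power_term c0 xc n zr); exists s.
have [f fP] := choice sums.
have f0 : f 0 = x 0.
  apply/eqP; rewrite -subr_eq0; apply/eqP/nrm_eq0/le_anti.
  rewrite nrm_ge0 andbT; apply: (@le_geo _ _ _ C0) => n; rewrite add0r.
  have := fP 0 _ n.+1; rewrite Normc.normc0 (ltW r0) => /(_ isT).
  rewrite big_ord_recl expr0 scale1r big1 => [|i _]; last first.
    by rewrite expr0n scale0r.
  by rewrite addr0 exprS invfM mulrACA mulfV ?mul1r.
have eqf z : normc z <= r -> S (f z) = z *: f z.
  move=> zr; apply/eqP; rewrite -subr_eq0; apply/eqP/nrm_eq0/le_anti.
  rewrite nrm_ge0 andbT.
  apply: (@le_geo _ _ _ (M * (2 * C0) + normc z * (2 * C0))) => n.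
  rewrite add0r.
  (* [S] shifts the partial sums by one term, whence the two lengths. *)
  have Ssum : S (\sum_(k < n.+1) z ^+ k *: x k) =
      z *: \sum_(k < n) z ^+ k *: x k.
    rewrite linear_sum big_ord_recl /= expr0 scale1r Sx0 add0r scaler_sumr.
    by apply: eq_bigr => i _; rewrite linearZ /= SxS exprS scalerA.
  have -> : S (f z) - z *: f z = S (f z - \sum_(k < n.+1) z ^+ k *: x k) -
      z *: (f z - \sum_(k < n) z ^+ k *: x k).
    by rewrite linearB Ssum scalerBr opprB addrA subrK.
  rewrite (le_trans (nrmB _ _))// mulrDl lerD//.
    rewrite (le_trans (SM _))// -mulrA ler_wpM2l//.
    rewrite (le_trans (fP _ zr _))// ler_wpM2l//.
      by have := le_trans (nrm_ge0 _) (fP _ zr 0%N); rewrite expr0 divr1.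
    by rewrite lef_pV2 ?posrE ?exprn_gt0// ler_weXn2l ?ler1n.
  by rewrite nrmZ -mulrA ler_wpM2l ?normc_ge0// fP.
have := svep _ (@open_disc _ l r) (@connected_disc _ l r) _
  (fun z => f (z - l)).
rewrite /= subrr Normc.normc0 => /(_ r0) H.
rewrite -f0 -(subrr l); apply: H; last by rewrite subrr Normc.normc0.
- move=> z zr.
  have [g [B gB]] := power_series_derivable c0 xc Wc fP zr.
  apply: (@derivable_quadratic _ _ _ _ g B (r - normc (z - l))); first lra.
  by move=> h hr; rewrite -[h + z - l]addrA; exact: gB.
- move=> z /ltW/eqf; rewrite SE /shift_op scalerBl => /addIr ->.
  exact: subrr.
Qed.

(** Take [q] such that [ker S `&` ran S^q] is contained in the range [H] of all
    powers. Then any preimage in [ran S^q] of a point [y] of [H] is again in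
    [H]: compare it with [S^(q+n) w], where [S^(q+n+1) w = y]. A bounded lift of
    [y] through [S^(q+1)] gives such a preimage with controlled norm, and
    iterating from a point of [ker S `&` ran S^q] gives the orbit to which
    [backward_orbit_svep] applies. *)
Lemma svep_finite_ascent k :
  reldim (iter 1 S @^-1` [set 0]) [set 0] k ->
  (forall n, exists2 D : R, 0 <= D & forall y, range (iter n S) y ->
     exists2 x, iter n S x = y & nrm x <= D * nrm y) ->
  svep_at T l ->
  exists q, iter q S @^-1` [set 0] = iter q.+1 S @^-1` [set 0].
Proof.
move=> k1 lift svep; have [M M0 SM] := shift_bounded.
have [q qP] := ker_ran_stabilizes k1.
exists q; apply: trivial_meet_ascent => x0 [kx0 rx0] /=.
pose H := [set x | forall n, range (iter n S) x].
have [D D0 DP] := lift q.+1.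
pose c := M ^+ q * D + 1.
have c0 : 0 < c by rewrite ltr_wpDl// mulr_ge0 ?exprn_ge0.
have step y : exists x, H y -> [/\ H x, S x = y & nrm x <= c * nrm y].
  have [Hy|?] := pselect (H y); last by exists 0.
  have [u uy uD] := DP y (Hy q.+1).
  exists (iter q S u) => _; split=> //.
    move=> n; have [w _ wy] := Hy (q + n).+1.
    have v_ker : iter 1 S (iter q S u - iter (q + n) S w) = 0.
      rewrite /= linearB; apply/eqP; rewrite subr_eq0; apply/eqP.
      exact: etrans uy (esym wy).
    have v_ran : range (iter q S) (iter q S u - iter (q + n) S w).
      apply: (subspaceB (subspace_ran S q)); first by exists u.
      by rewrite iterD; exists (iter n S w).
    rewrite -[iter q S u](subrK (iter (q + n) S w)).
    apply: (subspaceD (subspace_ran S n)); first exact: qP.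
    by rewrite addnC iterD; exists (iter q S w).
  rewrite (le_trans (iter_bounded q M0 SM _))// mulrDl mul1r.
  rewrite (@le_trans _ _ (M ^+ q * (D * nrm y)))//.
    by rewrite ler_wpM2l ?exprn_ge0.
  by rewrite mulrA lerDl nrm_ge0.
have [g gP] := choice step.
pose x n := iter n g x0.
have Hx n : H (x n).
  elim: n => [n|n IH]; first exact: qP.
  by have [] := gP _ IH.
have Sx n : S (x n.+1) = x n by have [] := gP _ (Hx n).
have xc n : nrm (x n) <= nrm x0 * c ^+ n.
  elim: n => [|n IH]; first by rewrite expr0 mulr1.
  have [_ _ /le_trans] := gP _ (Hx n); apply.
  by rewrite exprSr mulrA mulrC ler_wpM2r// ltW.
exact: (backward_orbit_svep c0 xc kx0 Sx svep).
Qed.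

End SvepAscent.

(** * Duality for operators with range of finite codimension *)

Section ShiftLinear.
Variables (K : numFieldType) (V : normedModType K).
Variables (T : bounded_operator V) (l : K).

Lemma shift_op_linear : linear (shift_op T l).
Proof.
move=> a x y; rewrite /shift_op linearP scalerDr scalerBr !scalerA mulrC.
by rewrite opprD addrACA.
Qed.

HB.instance Definition _ :=
  GRing.isLinear.Build K V V *:%R (shift_op T l) shift_op_linear.

Lemma weyl_reldim : weyl (shift_op T l) <->
  exists k, reldim (null_space (shift_op T l)) [set 0] k /\
            reldim setT (range (shift_op T l)) k.
Proof.
have sN := subspace_ker (shift_op T l) 1.
have sR := subspace_ran (shift_op T l) 1.
have dimE k : reldim (null_space (shift_op T l)) [set 0] k ->
    Defs.dim (null_space (shift_op T l)) = k.
  move=> hk; rewrite /Defs.dim; case: xgetP => [n _ hn|/(_ k)/=].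
    by apply: (reldim_unique (subspace0 V) _ hk); exact/(reldim_has_dim _ sN).
  by case; exact/(reldim_has_dim _ sN).
have codimE k : reldim setT (range (shift_op T l)) k ->
    codim (range (shift_op T l)) = k.
  move=> hk; rewrite /codim; case: xgetP => [n _ hn|/(_ k)/=].
    by apply: (reldim_unique sR _ hk); exact/reldim_has_codim.
  by case; exact/reldim_has_codim.
split=> [[[[n hn] [m hm]]]|[k [hn hm]]].
  have {}hn : reldim (null_space (shift_op T l)) [set 0] n.
    exact/(reldim_has_dim _ sN).
  have {}hm : reldim setT (range (shift_op T l)) m by exact/reldim_has_codim.
  rewrite /fredholm_index (dimE _ hn) (codimE _ hm) => /eqP.
  rewrite subr_eq0 eqz_nat => /eqP nm.
  by exists n; split=> //; rewrite nm.
split; last by rewrite /fredholm_index (dimE _ hn) (codimE _ hm) subrr.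
by split; exists k; [exact/(reldim_has_dim _ sN)|exact/reldim_has_codim].
Qed.

End ShiftLinear.

Section FiniteCodimension.
Variables (R : realType) (V : normedModType R[i]).
Hypothesis Vc : @geo_complete R V.
Variables (A : {linear V -> V}) (M : R) (M0 : 0 <= M).
Hypothesis AM : forall x, nrm (A x) <= M * nrm x.
Variable d : nat.
Hypothesis Ad : reldim [set: V] (range A) d.
Local Notation normc := Normc.normc.

Lemma finite_codim_lift : exists2 D : R, 0 <= D &
  forall y, range A y -> exists2 x, A x = y & nrm x <= D * nrm y.
Proof.
have [b [_ ib sb]] := Ad.
have [D D0 dec] := bounded_decomposition Vc M0 AM sb.
exists D => // y [x0 _ yE].
have [x [c [yD xD _]]] := dec y; exists x => //.
have c0 i : c i = 0.
  apply: ib; exists (x0 - x) => //.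
  by rewrite linearB /= yE {1}yD addrC addKr.
by rewrite yD big1 ?addr0// => i _; rewrite c0 scale0r.
Qed.

(** The coefficients [c i] in [v = A x + \sum_i c i b i] are unique, hence
    linear in [v], and they can be bounded; one of them is nonzero at [y]. This
    is the instance of the Hahn-Banach theorem needed for the dual operator. *)
Lemma separating_functional y : ~ range A y ->
  exists f : dual V, (forall x, f (A x) = 0) /\ f y != 0.
Proof.
move=> nAy; have [b [_ ib sb]] := Ad.
have [D D0 dec] := bounded_decomposition Vc M0 AM sb.
have [x xP] := choice dec; have [c cP] := choice xP.
(* Uniqueness of the coefficients. *)
have cE v z (e : 'I_d -> R[i]) : v = A z + \sum_i e i *: b i -> c v = e.
  move=> vE; apply/funext => i; apply/eqP; rewrite -subr_eq0; apply/eqP.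
  apply: (ib (fun i => c v i - e i)).
  exists (z - x v) => //; under eq_bigr do rewrite scalerBl.
  rewrite sumrB linearB; have [vE' _ _] := cP v.
  have -> : A z = v - \sum_i e i *: b i by rewrite {1}vE addrK.
  have -> : A (x v) = v - \sum_i c v i *: b i by rewrite {2}vE' addrK.
  by rewrite opprB addrC addrA subrK.
have [i ci] : exists i, c y i != 0.
  apply: contrapT => /forallNP h; apply: nAy; exists (x y) => //.
  have [yE _ _] := cP y; rewrite [RHS]yE big1 ?addr0// => i _.
  by have /negP := h i; rewrite negbK => /eqP ->; rewrite scale0r.
have lc : linear (fun v => c v i : R[i]^o).
  move=> a v w; have [vE _ _] := cP v; have [wE _ _] := cP w.
  rewrite (cE (a *: v + w) (a *: x v + x w) (fun i => a * c v i + c w i))//.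
  rewrite {1}vE {1}wE linearP scalerDr addrACA; congr (_ + _).
  rewrite scaler_sumr -big_split; apply: eq_bigr => j _ /=.
  by rewrite scalerDl scalerA.
have [f fE] := dual_of lc (fun v => let: And3 _ _ h := cP v in h i).
exists f; split=> [z|]; last by rewrite fE.
rewrite fE (cE (A z) z (fun=> 0))// big1 ?addr0// => j _.
by rewrite scale0r.
Qed.

End FiniteCodimension.

Section DualFredholm.
Variables (R : realType) (V : normedModType R[i]).
Hypothesis Vc : @geo_complete R V.
Variables (T : bounded_operator V) (l : R[i]).
Local Notation S := (shift_op T l).
Local Notation S' := (shift_op (dual_op T) l).

Lemma dual_shift_iterE n f x : iter n S' f x = f (iter n S x).
Proof.
elim: n f x => // n IH f x; rewrite iterSr IH [in RHS]iterS.
set y := iter n S x.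
have -> : S' f y = f (T y) - l * f y by [].
have -> : S y = (- l) *: y + T y by rewrite scaleNr addrC.
have := dual_linear f (- l) y (T y); rewrite /= => ->.
by rewrite scaleNr addrC.
Qed.

(** A functional killed by the dual of [S] vanishes on the range of [S], hence
    is determined by its values on a basis [b] of a complement. *)
Lemma dual_ker_finite k : reldim setT (range S) k ->
  exists k', reldim (iter 1 S' @^-1` [set 0]) [set 0] k'.
Proof.
move=> [b [_ _ sb]]; apply: (@reldim_bounded _ _ _ _ k); first exact: subspace0.
move=> n f kf indf.
apply: (@independent_le_spanning _ 'rV[R[i]]_k setT [set 0] n k
  (fun i => \row_j (f i (b j) : R[i])) (fun j => delta_mx 0 j)) => //.
- exact: subspace0.
- move=> c c0; apply: indf => /=; apply: dualP => v.
  rewrite [RHS](_ : _ = 0)//.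
  have S0 y : (\sum_i c i *: f i) (S y) = 0.
    rewrite dual_sumE big1// => i _; rewrite dualZE.
    have : S' (f i) y = 0 by rewrite [S' (f i)](kf i).
    by have := dual_shift_iterE 1 (f i) y; rewrite /= => -> ->; rewrite mulr0.
  have [e [y _ yE]] := sb v I.
  rewrite -[v](subrK (\sum_(j < k) e j *: b j)) -yE.
  have := dual_linear (\sum_i c i *: f i) 1 (S y) (\sum_(j < k) e j *: b j).
  rewrite !scale1r => ->; rewrite S0 add0r.
  have comb0 (F : dual V) : (forall j, F (b j) = 0) ->
      F (\sum_(j < k) e j *: b j) = 0.
    move=> Fb; elim/big_ind: _ => [|x z Fx Fz|j _]; first exact: dual0.
      by have := dual_linear F 1 x z; rewrite !scale1r Fx Fz addr0.
    by rewrite dualZ Fb mulr0.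
  apply: comb0 => j; rewrite dual_sumE.
  have := congr1 (fun M : 'rV_k => M 0 j) c0; rewrite summxE mxE => sum0.
  by rewrite -[RHS]sum0; apply: eq_bigr => i _; rewrite !mxE.
- move=> x _; exists (fun j => x 0 j) => /=.
  by rewrite -row_sum_delta subrr.
Qed.

(** Given [g] in the range of the dual of [S^n], put [f v = g x] where [v = S^n
    x + \sum_i c i b i]. This does not depend on the choice of [x], as [g]
    vanishes on [ker S^n], and the bound on [x] bounds [f]. *)
Lemma dual_iter_lift n k : reldim setT (range S) k ->
  exists2 D : R, 0 <= D & forall g, range (iter n S') g ->
    exists2 f, iter n S' f = g & nrm f <= D * nrm g.
Proof.
move=> Sk; have [d Sd] := ran_finite n Sk.
have [M M0 SM] := shift_bounded (T := T) (l := l) (S := S) (fun=> erefl).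
have [b [_ ib sb]] := Sd.
have [D D0 dec] := bounded_decomposition Vc (exprn_ge0 n M0)
  (iter_bounded n M0 SM) sb.
have [x xP] := choice dec; have [c cP] := choice xP.
exists D => // g [f0 _ gE].
have gf0 z : g z = f0 (iter n S z) by rewrite -gE dual_shift_iterE.
(* The value [g (x v)] does not depend on the chosen decomposition. *)
have gx v z (e : 'I_d -> R[i]) :
    v = iter n S z + \sum_i e i *: b i -> g (x v) = g z.
  move=> vE; rewrite !gf0; congr (f0 _); have [vE' _ _] := cP v.
  have ce i : c v i - e i = 0.
    apply: (ib (fun i => c v i - e i)); exists (z - x v) => //.
    under eq_bigr do rewrite scalerBl.
    rewrite sumrB linearB /=.
    have -> : iter n S z = v - \sum_i e i *: b i by rewrite {1}vE addrK.
    have -> : iter n S (x v) = v - \sum_i c v i *: b i by rewrite {2}vE' addrK.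
    by rewrite opprB addrC addrA subrK.
  have -> : iter n S z = v - \sum_i e i *: b i by rewrite {1}vE addrK.
  have -> : iter n S (x v) = v - \sum_i c v i *: b i by rewrite {2}vE' addrK.
  congr (v - _); apply: eq_bigr => i _.
  by have /eqP := ce i; rewrite subr_eq0 => /eqP ->.
have lg : linear (fun v => g (x v) : R[i]^o).
  move=> a v w; have [vE _ _] := cP v; have [wE _ _] := cP w.
  rewrite (gx (a *: v + w) (a *: x v + x w) (fun i => a * c v i + c w i)).
    exact: dual_linear.
  rewrite {1}vE {1}wE linearP scalerDr addrACA; congr (_ + _).
  rewrite scaler_sumr -big_split; apply: eq_bigr => j _ /=.
  by rewrite scalerDl scalerA.
have bd v : nrm (g (x v) : R[i]^o) <= (D * nrm g) * nrm v.
  have [_ xD _] := cP v.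
  rewrite (le_trans (nrm_dual_le _ _))// mulrAC mulrC.
  by rewrite ler_wpM2r ?nrm_ge0// mulrC.
have [f fE] := dual_of lg bd.
exists f; last first.
  apply: nrm_dual_ub; first by rewrite mulr_ge0 ?nrm_ge0.
  by move=> v; rewrite fE.
apply: dualP => z; rewrite dual_shift_iterE fE.
apply: (gx _ z (fun=> 0)); rewrite big1 ?addr0// => j _.
by rewrite scale0r.
Qed.

(** The kernel of the dual of [S^n] is the annihilator of the range of [S^n]. A
    point of [ran S^n] outside [ran S^(n+1)] would be separated from the latter
    by a functional that annihilates it, hence annihilates [ran S^n] and the
    point itself. *)
Lemma dual_stable_ker_stable_ran n k : reldim setT (range S) k ->
  null_space (iter n S') = null_space (iter n.+1 S') ->
  range (iter n S) = range (iter n.+1 S).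
Proof.
move=> Sk nS; apply/seteqP; split; last exact: ran_anti.
move=> y [x _ xy]; apply: contrapT => ny.
have [d Sd] := ran_finite n.+1 Sk.
have [M M0 SM] := shift_bounded (T := T) (l := l) (S := S) (fun=> erefl).
have [f [f0 fy]] := separating_functional Vc (exprn_ge0 n.+1 M0)
  (iter_bounded n.+1 M0 SM) Sd ny.
have : null_space (iter n.+1 S') f.
  by apply: dualP => z; rewrite dual_shift_iterE f0.
rewrite -nS => /(congr1 (fun h : dual V => h x)).
by rewrite dual_shift_iterE xy => fy0; rewrite fy0 eqxx in fy.
Qed.

End DualFredholm.

(** * Browder's theorem and the equivalence *)

Section Browder.
Variables (R : realType) (X : completeNormedModType R[i]).
Variables (T : bounded_operator X) (l : R[i]).
Local Notation S := (shift_op T l).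

(** SVEP of [T] gives finite ascent directly, SVEP of the dual gives finite
    ascent of the dual and so finite descent of [S]; the vanishing index
    transfers each condition to the other. *)
Lemma weyl_svep_chain_conditions : weyl S ->
  svep_at T l \/ svep_at (dual_op T) l ->
  finite_ascent S /\ finite_descent S.
Proof.
move=> /weyl_reldim[k [Nk Rk]].
have [M M0 SM] := shift_bounded (T := T) (l := l) (S := S) (fun=> erefl).
case=> [svep|svep].
  have lift n := let: ex_intro d Sd := ran_finite n Rk in
    finite_codim_lift (@complete_geo_complete R X) (exprn_ge0 n M0)
      (iter_bounded n M0 SM) Sd.
  have [p kp] := svep_finite_ascent (@complete_geo_complete R X)
    (fun=> erefl) Nk lift svep.
  by split; exists p => //; exact: stable_ker_stable_ran kp Nk Rk.
have [k' k'P] := dual_ker_finite Rk.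
have [q kq] := svep_finite_ascent (@dual_geo_complete R X) (fun=> erefl) k'P
  (fun n => dual_iter_lift (@complete_geo_complete R X) n Rk) svep.
have rq : range (iter q S) = range (iter q.+1 S).
  exact: (dual_stable_ker_stable_ran (@complete_geo_complete R X) Rk).
split; exists q => //.
exact/trivial_meet_ascent/(ker_meet_stable_ran rq Nk Rk).
Qed.

Lemma finite_rank_pole_weyl : finite_rank_poles T l -> weyl S.
Proof.
move=> [[_ [[p kp] [q rq]]] [k Nk]]; apply/weyl_reldim; exists k.
have {}Nk : reldim (null_space S) [set 0] k.
  exact/(reldim_has_dim _ (subspace_ker S 1)).
by split=> //; exact: (codim_ran_of_stable kp rq Nk).
Qed.

End Browder.

Theorem proposition2p12 (R : realType) (X : completeNormedModType R[i])
    (Xinf : ~ finite_dim [set: X]) (T : bounded_operator X)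
    (hsvep : svep_on T (~` weyl_spectrum T) \/
             svep_on (dual_op T) (~` weyl_spectrum T)) :
  property_Z_Ea T <-> isolated_approx_eigenvalues T = finite_rank_poles T.
Proof.
suff browder : spectrum T `\` weyl_spectrum T = finite_rank_poles T.
  by rewrite /property_Z_Ea browder; split=> ->.
apply/seteqP; split=> l.
  move=> [sl /contrapT wl]; have svep : svep_at T l \/ svep_at (dual_op T) l.
    by case: hsvep => h; [left|right]; apply: h => /(_ wl).
  split; last by case: wl => -[].
  by split=> //; exact: weyl_svep_chain_conditions.
by move=> pl; split; [case: pl => -[]|move=> /(_ (finite_rank_pole_weyl pl))].
Qed.
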